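(* Let $W$ be any Coxeter group and let $u \leq v$ be elements of $W$ (in Bruhat order). Then $d_{u,v} = g_{u,v}$.
   Context: Let $(W,S)$ be a Coxeter system with length function $\ell$, Bruhat order $\leq$, and set of reflections $T$ (conjugates of elements of $S$); write $\ell(x,y)=\ell(y)-\ell(x)$. The Kazhdan--Lusztig $R$-polynomials $R_{x,y}\in\mathbb{Z}[q]$ are the unique family with: $R_{x,y}=0$ if $x\not\leq y$; $R_{x,x}=1$; and if $x<y$ and $s\in S$ with $sy<y$, then $R_{x,y}=R_{sx,sy}$ if $sx<x$, and $R_{x,y}=(q-1)R_{x,sy}+qR_{sx,sy}$ if $sx>x$. For $u\leq v$, $R_{u,v}$ is monic of degree $\ell(u,v)$, and the $d$-invariant $d_{u,v}\in\mathbb{N}$ is defined by $R_{u,v}=q^{\ell(u,v)}-d_{u,v}q^{\ell(u,v)-1}+\cdots$, i.e. $d_{u,v}=-[q^{\ell(u,v)-1}]R_{u,v}$. The Bruhat graph is the directed graph on $W$ with an edge $x\to y$ whenever $y=tx$ for some $t\in T$ and $\ell(x)<\ell(y)$. Let $\widehat{\Gamma}_{u,v}$ be the underlying undirected graph of the induced subgraph on the Bruhat interval $[u,v]$, and $E_{u,v}$ its edge set. A set $F\subseteq E_{u,v}$ is diamond-closed if, whenever it contains two consecutive edges of a $4$-cycle of $\widehat{\Gamma}_{u,v}$, it also contains the other two edges of that $4$-cycle. The diamond-closure $F^{\diamond}$ is the smallest diamond-closed subset of $E_{u,v}$ containing $F$; $F$ is diamond-generating if $F^{\diamond}=E_{u,v}$.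 Then $g_{u,v}$ is the minimum size of a diamond-generating subset of $E_{u,v}$. *)

(* Defs.v *)
From HB Require Import structures.
From mathcomp Require Import all_boot all_order all_algebra.
From mathcomp Require Import all_classical.
From Stdlib Require Import Relation_Operators.

Set Implicit Arguments.
Unset Strict Implicit.
Unset Printing Implicit Defensive.

Import GRing.Theory.

Local Open Scope classical_set_scope.
Local Open Scope group_scope.

(* Only the values of [m] on S x S matter; the value 0 encodes the entry
   infinity, so that the relation (s * t) ^+ m s t = 1 is then void. *)
Definition coxeter_matrix (I : Type) (S : set I) (m : I -> I -> nat) : Prop :=
  [/\ forall s, S s -> m s s = 1%N,
      forall s t, S s -> S t -> m s t = m t s &
      forall s t, S s -> S t -> s <> t -> m s t <> 1%N].

(* W is presented by the generators S and the relations (st)^m(s,t) = 1: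
   S generates W, the relations hold in W, and every map from S to a group that
   respects the relations extends to a homomorphism on W.  Since s^2 = 1 is
   among the relations, words in S without inverses suffice for generation. *)
Record coxeter_presentation (W : groupType) (S : set W) (m : W -> W -> nat) :
    Prop := CoxeterPresentation {
  cox_generated : forall w : W, exists2 c : seq W,
    (forall s, s \in c -> S s) & \prod_(s <- c) s = w;
  cox_relations : forall s t, S s -> S t -> (s * t) ^+ m s t = 1;
  cox_universal : forall (G : groupType) (f : W -> G),
    (forall s t, S s -> S t -> (f s * f t) ^+ m s t = 1) ->
    exists2 h : W -> G, {morph h : x y / x * y} & {in S, h =1 f} }.

Record coxeterSystem := CoxeterSystem {
  cox_group :> groupType;
  cox_gens : set cox_group;
  cox_system : exists2 m : cox_group -> cox_group -> nat,
    coxeter_matrix cox_gens m & coxeter_presentation cox_gens m }.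

Section Coxeter.
Variable W : coxeterSystem.
Implicit Types (x y u v s t w : W).

Local Notation S := (@cox_gens W).

Definition expressible w (n : nat) : Prop :=
  exists c : seq W,
    [/\ forall s, s \in c -> S s, \prod_(s <- c) s = w & size c = n].

Lemma expressible_ex w : exists n, `[< expressible w n >].
Proof.
have [m _ [gen _ _]] := cox_system W.
by have [c Sc cw] := gen w; exists (size c); apply/asboolP; exists c.
Qed.

Definition cox_length w : nat := ex_minn (expressible_ex w).

Definition reflections : set W :=
  [set t | exists w s, S s /\ t = w * s * w^-1].

Definition bruhat_edge x y : Prop :=
  (exists2 t, reflections t & y = t * x) /\ (cox_length x < cox_length y)%N.

Definition bruhat_le : W -> W -> Prop := clos_refl_trans W bruhat_edge.

Definition bruhat_lt x y : Prop := bruhat_le x y /\ x <> y.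

Definition bruhat_interval u v : set W :=
  [set x | bruhat_le u x /\ bruhat_le x v].

Section RPolynomials.
Local Open Scope ring_scope.

Definition KL_R_family (R : W -> W -> {poly int}) : Prop :=
  [/\ forall x y, ~ bruhat_le x y -> R x y = 0,
      forall x, R x x = 1,
      forall x y s, bruhat_lt x y -> S s -> bruhat_lt (s * y)%g y ->
        bruhat_lt (s * x)%g x -> R x y = R (s * x)%g (s * y)%g &
      forall x y s, bruhat_lt x y -> S s -> bruhat_lt (s * y)%g y ->
        bruhat_lt x (s * x)%g ->
        R x y = ('X - 1) * R x (s * y)%g + 'X * R (s * x)%g (s * y)%g].

(* The coefficient of q^(l(u,v) - 1) in R u v, read off as the coefficient of
   q^l(u,v) in q * R u v so that it is 0, as it should be, when u = v (where
   the truncated subtraction l(u,v) - 1 would give 0). *)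
Definition d_invariant (R : W -> W -> {poly int}) u v : int :=
  - ('X * R u v)`_(cox_length v - cox_length u)%N.

End RPolynomials.

(* Undirected edges are unordered pairs, that is, two-element sets. *)
Definition interval_edges u v : set (set W) :=
  [set e | exists x y, [/\ bruhat_interval u v x, bruhat_interval u v y,
                           bruhat_edge x y & e = [set x; y]]].

(* [E] is the edge set of a graph; a, b, c, d are the successive vertices of a
   4-cycle (adjacent ones are distinct since [interval_edges] has no loops). *)
Definition four_cycle (E : set (set W)) (a b c d : W) : Prop :=
  [/\ a <> c, b <> d & [/\ E [set a; b], E [set b; c], E [set c; d] &
                           E [set d; a]]].

Definition diamond_closed u v (F : set (set W)) : Prop :=
  F `<=` interval_edges u v /\
  forall a b c d, four_cycle (interval_edges u v) a b c d ->
    F [set a; b] -> F [set b; c] -> F [set c; d] /\ F [set d; a].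

Definition diamond_closure u v (F : set (set W)) : set (set W) :=
  smallest (diamond_closed u v) F.

Definition diamond_generating u v (F : set (set W)) : Prop :=
  F `<=` interval_edges u v /\ diamond_closure u v F = interval_edges u v.

Definition generating_size u v (n : nat) : Prop :=
  exists2 F : set (set W), diamond_generating u v F & (F #= `I_n)%card.

(* Bruhat intervals are finite, so the minimum exists; the default value 0 of
   [xget] is not used. *)
Definition g_invariant u v : nat :=
  xget 0%N [set n | generating_size u v n /\
                    forall k, generating_size u v k -> (n <= k)%N].

End Coxeter.

(* Main.v *)
(* Upper bound.  Suppose u < v.  Removing common left factors along reduced
   products gives u = z p and v = z w with lengths adding up, and a generator r
   with p < r p, r w < w.  Then a = z r p covers u, and the recursion for R gives
   d(u, v) = d(a, v) + 1 if r p is not below r w, and d(u, v) = d(a, v) otherwise.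
   Adding the edge {u, a} to a generating set of [a, v] generates [u, v] since the
   atoms of [u, v] are linked by diamonds.  When r p <= r w the edge {u, a} lies
   in the closure already: a four-cycle through u and a has its two other edges
   above u, and these are reached by induction.

   Lower bound.  In the geometric representation attach to an edge x -> y the
   line of linear forms negated by the reflection x^-1 y, and call potential a
   map f from [u, v] to functions with f y - f x in that line for every edge.
   Lines of distinct reflections are independent, so the edges on which a
   potential is constant form a diamond-closed set.  The space of potentials
   modulo constants has dimension at least d(u, v), by the same recursion: a
   potential on [u, s v] extends to [u, v], and the form x |-> x^-1 alpha_s gives
   a new one when s u is not below s v.  Hence fewer than d(u, v) edges cannot
   generate. *)
Require Import Defs.
From HB Require Import structures.
From mathcomp Require Import all_boot all_order all_fingroup all_algebra.
From mathcomp Require Import all_classical.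
From mathcomp Require Import Rstruct reals trigo.
From mathcomp Require Import zify ring lra.
From Stdlib Require Import Relation_Operators Operators_Properties.

Set Implicit Arguments.
Unset Strict Implicit.
Unset Printing Implicit Defensive.

(** * Length and reflections *)

(** Both bounds use the polynomials only through [d_recursion]. The delicate point is the closure
    argument when r p <= r w. A left factor z transports Bruhat relations only where its products
    are length additive. The vertex opposite to a = z r p in the four-cycle is z x, where x may be
    longer than p by three, so additivity of z x is not guaranteed and z x cannot serve as the
    bottom of a smaller instance. The induction therefore runs over all decompositions z w of a
    fixed top element, and decompositions adapted to z x are built by moving the letters of z across
    one at a time. For the same reason atoms and covers are studied together with a left factor z:
    the condition z < z t on a reflection t is what keeps additivity when passing from p to a cover
    t p. Roots are handled as functions on the dual space, whose dominant points detect the signs of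
    roots and the identity of W. This needs nothing from the bilinear form, which may be degenerate
    when W is infinite. *)

Section Length.
Variable W : coxeterSystem.
Implicit Types (x y z u v w s t p q : W).
Local Open Scope classical_set_scope.
Local Open Scope group_scope.
Local Notation S := (@cox_gens W).
Local Notation T := (@reflections W).
Local Notation len := (@cox_length W).

Lemma gen_sq s : S s -> s * s = 1.
Proof.
move=> Ss; have [m [m1 _ _] [_ rel _]] := cox_system W.
by have := rel s s Ss Ss; rewrite m1 // expg1.
Qed.

Lemma gen_inv s : S s -> s^-1 = s.
Proof. by move=> /gen_sq; exact: mulg1_eq. Qed.

Lemma genK s x : S s -> s * (s * x) = x.
Proof. by move=> Ss; rewrite mulgA gen_sq // mul1g. Qed.

Lemma mulgenK s x : S s -> x * s * s = x.
Proof. by move=> Ss; rewrite -mulgA gen_sq // mulg1. Qed.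

(** The universal property applied to the permutations of two points, with every generator going to
    the transposition. Parity is what excludes equal lengths of x and t x. *)
Lemma sign_morphism : exists e : W -> bool,
  {morph e : x y / x * y >-> x (+) y} /\ forall s, S s -> e s.
Proof.
have [m _ [_ _ univ]] := cox_system W.
have [|h hM hS] := univ {perm bool} (fun=> tperm true false).
  by move=> s t _ _; rewrite tperm2 expg1n.
exists (fun x => odd_perm (h x)); split.
  by move=> x y; rewrite hM odd_permM.
by move=> s Ss; rewrite hS ?in_setE // odd_tperm.
Qed.

Lemma lenP w : expressible w (len w).
Proof. by rewrite /cox_length; case: ex_minnP => n /asboolP. Qed.

Lemma len_min w n : expressible w n -> (len w <= n)%N.
Proof.
by rewrite /cox_length => wn; case: ex_minnP => k _; apply; apply/asboolP.
Qed.

Lemma len_prod c : (forall s, s \in c -> S s) ->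
  (len (\prod_(s <- c) s) <= size c)%N.
Proof. by move=> Sc; apply: len_min; exists c. Qed.

Lemma reduced_word w : exists c : seq W,
  [/\ forall s, s \in c -> S s, \prod_(s <- c) s = w & size c = len w].
Proof. exact: lenP. Qed.

Lemma len1 : len 1 = 0%N.
Proof. by apply/eqP; rewrite -leqn0; apply: len_min; exists [::]; rewrite big_nil. Qed.

Lemma len_eq0 w : len w = 0%N -> w = 1.
Proof.
move=> w0; have [c [_ pc]] := reduced_word w; rewrite w0 => /size0nil c0.
by rewrite -pc c0 big_nil.
Qed.

Lemma lenM x y : (len (x * y) <= len x + len y)%N.
Proof.
have [c [Sc <- <-]] := reduced_word x; have [d [Sd <- <-]] := reduced_word y.
rewrite -big_cat -size_cat; apply: len_prod => s; rewrite mem_cat.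
by case/orP; [exact: Sc | exact: Sd].
Qed.

Lemma lenV x : len x^-1 = len x.
Proof.
suff le z : (len z^-1 <= len z)%N.
  by apply/eqP; rewrite eqn_leq le /= -{1}[x]invgK le.
have [c [Sc <- <-]] := reduced_word z; rewrite -(size_rev c).
suff -> : (\prod_(s <- c) s)^-1 = \prod_(s <- rev c) s.
  by apply: len_prod => s; rewrite mem_rev; exact: Sc.
elim: c Sc => [|a c IH] Sc; first by rewrite big_nil invg1.
rewrite big_cons invgM IH => [|s sc]; last by apply: Sc; rewrite inE sc orbT.
by rewrite rev_cons -cats1 big_cat big_seq1 gen_inv //; apply: Sc; rewrite inE eqxx.
Qed.

Lemma sign_len (e : W -> bool) : {morph e : x y / x * y >-> x (+) y} ->
  (forall s, S s -> e s) -> forall x, e x = odd (len x).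
Proof.
move=> eM eS x; have [c [Sc <- <-]] := reduced_word x.
elim: c Sc => [|a c IH] Sc.
  by rewrite big_nil; have := eM 1 1; rewrite mulg1; case: (e 1).
rewrite big_cons eM IH => [|s sc]; last by apply: Sc; rewrite inE sc orbT.
by rewrite eS //; apply: Sc; rewrite inE eqxx.
Qed.

Lemma odd_lenM x y : odd (len (x * y)) = odd (len x) (+) odd (len y).
Proof. by have [e [eM eS]] := sign_morphism; rewrite -!(sign_len eM eS) eM. Qed.

Lemma odd_len_refl t : T t -> odd (len t).
Proof.
have [e [eM eS]] := sign_morphism; move=> [w [s [Ss ->]]].
by rewrite -(sign_len eM eS) !eM !(sign_len eM eS) lenV -!(sign_len eM eS) (eS s Ss) addbC; case: (e w).
Qed.

Lemma refl_gen s : S s -> T s.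
Proof. by move=> Ss; exists 1, s; rewrite mul1g invg1 mulg1. Qed.

Lemma refl_conj t g : T t -> T (g * t * g^-1).
Proof. by move=> [w [s [Ss ->]]]; exists (g * w), s; rewrite invgM !mulgA. Qed.

Lemma refl_conjV t g : T t -> T (g^-1 * t * g).
Proof. by move=> /(refl_conj g^-1); rewrite invgK. Qed.

Lemma refl_sq t : T t -> t * t = 1.
Proof.
move=> [w [s [Ss ->]]]; rewrite !mulgA mulgVK -[w * s * s]mulgA gen_sq //.
by rewrite mulg1 mulgV.
Qed.

Lemma refl_inv t : T t -> t^-1 = t.
Proof. by move=> /refl_sq; exact: mulg1_eq. Qed.

Lemma reflK t x : T t -> t * (t * x) = x.
Proof. by move=> Tt; rewrite mulgA refl_sq // mul1g. Qed.

Lemma refl_conj_gen s t : S s -> T t -> T (s * t * s).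
Proof. by move=> Ss /(refl_conj s); rewrite gen_inv. Qed.

Lemma len_gen s : S s -> len s = 1%N.
Proof.
move=> Ss; have : (len s <= 1)%N.
  by apply: len_min; exists [:: s]; rewrite big_seq1; split=> // r; rewrite inE => /eqP ->.
by have := odd_len_refl (refl_gen Ss); case: (len s) => [|[]].
Qed.

Lemma odd_len_reflM t x : T t -> odd (len (t * x)) = ~~ odd (len x).
Proof. by move=> Tt; rewrite odd_lenM odd_len_refl. Qed.

Lemma len_refl_neq t x : T t -> len (t * x) <> len x.
Proof. by move=> Tt E; have := odd_len_reflM x Tt; rewrite E; case: odd. Qed.

Lemma refl_ltP t x : T t -> (len x < len (t * x))%N \/ (len (t * x) < len x)%N.
Proof. move=> Tt; case: (ltngtP (len x) (len (t * x))) => [||E]; [by left|by right|].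
by case: (@len_refl_neq t x Tt). Qed.

Lemma len_genM s x : S s -> (len (s * x) <= (len x).+1)%N.
Proof. by move=> Ss; have := lenM s x; rewrite (len_gen Ss) add1n. Qed.

Lemma len_genMge s x : S s -> (len x <= (len (s * x)).+1)%N.
Proof. by move=> Ss; rewrite -{1}(genK x Ss) len_genM. Qed.

Lemma len_up s x : S s -> (len x < len (s * x))%N -> len (s * x) = (len x).+1.
Proof. by move=> Ss; have := len_genM x Ss; lia. Qed.

Lemma len_down s x : S s -> (len (s * x) < len x)%N -> len x = (len (s * x)).+1.
Proof. by move=> Ss; have := len_genMge x Ss; lia. Qed.

Lemma gen_ltP s x : S s -> (len x < len (s * x))%N \/ (len (s * x) < len x)%N.
Proof. by move=> /refl_gen; exact: refl_ltP. Qed.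

Lemma left_descent x : x <> 1 -> exists2 s, S s & (len (s * x) < len x)%N.
Proof.
move=> x1; have [[|s c] [Sc px sx]] := reduced_word x.
  by case: x1; rewrite -px big_nil.
have Ss : S s by apply: Sc; rewrite inE eqxx.
exists s => //; have -> : s * x = \prod_(r <- c) r by rewrite -px big_cons genK.
rewrite -sx /= ltnS.
by apply: len_prod => r rc; apply: Sc; rewrite inE rc orbT.
Qed.

Lemma right_descent x : x <> 1 -> exists2 s, S s & (len (x * s) < len x)%N.
Proof.
move=> x1; have [|s Ss] := @left_descent x^-1.
  by move=> E; apply: x1; rewrite -[x]invgK E invg1.
by move=> lt; exists s => //; rewrite -(lenV (x * s)) invgM gen_inv // -(lenV x).
Qed.

End Length.

(** * The geometric representation *)

Section DihedralNumbers.
Variable R : realType.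
Import Order.TTheory GRing.Theory Num.Theory.
Local Open Scope ring_scope.

(** Pairs of consecutive values U_(n-1)(k/2) of the Chebyshev polynomials of the second kind,
    starting from 0, 1. They are the coordinates of the roots of a dihedral group. *)
Fixpoint cheb (k : R) (n : nat) : R * R :=
  if n is n'.+1 then let: (a, b) := cheb k n' in (b, k * b - a) else (0, 1).
Definition chebyshev k n := (cheb k n).1.

Lemma chebyshev0 k : chebyshev k 0 = 0. Proof. by []. Qed.
Lemma chebyshev1 k : chebyshev k 1 = 1. Proof. by []. Qed.
Lemma chebyshevSS k n :
  chebyshev k n.+2 = k * chebyshev k n.+1 - chebyshev k n.
Proof. by rewrite /chebyshev /=; case: (cheb k n). Qed.

Lemma chebyshev2 n : chebyshev 2 n = n%:R.
Proof.
suff : chebyshev 2 n = n%:R /\ chebyshev 2 n.+1 = n.+1%:R by case.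
elim: n => [|n [IH1 IH2]]; first by [].
by split=> //; rewrite chebyshevSS IH1 IH2 -!natr1; ring.
Qed.

Lemma chebyshev_sin (x : R) n :
  sin x != 0 -> chebyshev (2 * cos x) n = sin (n%:R * x) / sin x.
Proof.
move=> sx0.
suff : chebyshev (2 * cos x) n = sin (n%:R * x) / sin x /\
  chebyshev (2 * cos x) n.+1 = sin (n.+1%:R * x) / sin x by case.
elim: n => [|n [IH1 IH2]].
  by rewrite chebyshev0 chebyshev1 mul0r sin0 mul0r mul1r divff.
split=> //; rewrite chebyshevSS IH1 IH2 mulrA -mulrBl; congr (_ / _).
rewrite -!natr1 !mulrDl !mul1r !sinD !cosD; apply/eqP.
rewrite -subr_eq0; set c := cos x; set d := sin x; set e := sin (n%:R * x).
rewrite (_ : _ - _ = e * (c ^+ 2 + d ^+ 2 - 1)); last by ring.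
by rewrite cos2Dsin2 subrr mulr0.
Qed.

(** Take k = 2 cos (pi / m). The values up to m give the signs of the roots of the dihedral group of
    order 2m; those at 2m and 2m + 1 make the m-th power of the rotation trivial. *)
Lemma dihedral_numbers m : (1 < m)%N -> exists k : R, [/\ k ^+ 2 < 4,
  forall n, (0 < n < m)%N -> 0 < chebyshev k n, chebyshev k m = 0,
  chebyshev k m.*2 = 0 & chebyshev k m.*2.+1 = 1].
Proof.
move=> m1; pose x : R := pi / m%:R.
have m0 : 0 < m%:R :> R by rewrite ltr0n; lia.
have mx : m%:R * x = pi by rewrite /x mulrC divfK // gt_eqF.
have x0 : 0 < x by rewrite divr_gt0 // pi_gt0.
have sgt0 n : (0 < n < m)%N -> 0 < sin (n%:R * x).
  move=> nm; apply: sin_gt0_pi; rewrite mulr_gt0 ?ltr0n //=; last by lia.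
  by rewrite -mx ltr_pM2r // ltr_nat; lia.
have s0 : 0 < sin x by have := sgt0 1; rewrite mul1r; apply; lia.
have sN0 : sin x != 0 by rewrite gt_eqF.
exists (2 * cos x); split.
- have := cos2Dsin2 x; have : 0 < sin x ^+ 2 by rewrite exprn_gt0.
  by rewrite exprMn; lra.
- by move=> n nm; rewrite chebyshev_sin // divr_gt0 // sgt0.
- by rewrite chebyshev_sin // mx sinpi mul0r.
- by rewrite chebyshev_sin // -muln2 natrM mulrAC mx mulr_natr sin2pi mul0r.
rewrite chebyshev_sin // -natr1 mulrDl mul1r addrC -muln2 natrM mulrAC mx.
by rewrite mulr_natr sinD2pi divff.
Qed.
End DihedralNumbers.

(** Carrying the inverse makes these a group, so that the universal property of the presentation
    applies to transformations of an infinite set. *)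
Record bijection (X : Type) := Bijection {
  bij_fun :> X -> X;
  bij_inv : X -> X;
  bij_funK : cancel bij_fun bij_inv;
  bij_invK : cancel bij_inv bij_fun }.

Section BijectionGroup.
Variable X : Type.
Implicit Types f g : bijection X.

Lemma bijectionP f g : f =1 g -> f = g.
Proof.
case: f g => [f f' fK f'K] [g g' gK g'K] /= /funext fg; subst g.
have f'g' : f' = g' by apply/funext => x; rewrite -{1}[x]g'K fK.
by subst g'; rewrite (Prop_irrelevance fK gK) (Prop_irrelevance f'K g'K).
Qed.

Definition bij_one := @Bijection X id id (fun=> erefl) (fun=> erefl).
Definition bij_opp f := Bijection (bij_invK f) (bij_funK f).
Definition bij_mul f g :=
  Bijection (can_comp (bij_funK f) (bij_funK g))
            (can_comp (bij_invK g) (bij_invK f)).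

Let bij_mulA : associative bij_mul. Proof. by move=> f g h; exact: bijectionP. Qed.
Let bij_mul1 : left_id bij_one bij_mul. Proof. by move=> f; exact: bijectionP. Qed.
Let bij_mulr1 : right_id bij_one bij_mul. Proof. by move=> f; exact: bijectionP. Qed.
Let bij_mulV : left_inverse bij_one bij_opp bij_mul.
Proof. by move=> f; apply: bijectionP => x /=; rewrite bij_funK. Qed.
Let bij_mulVr : right_inverse bij_one bij_opp bij_mul.
Proof. by move=> f; apply: bijectionP => x /=; rewrite bij_invK. Qed.

HB.instance Definition _ := gen_eqMixin (bijection X).
HB.instance Definition _ := gen_choiceMixin (bijection X).
HB.instance Definition _ := isGroup.Build (bijection X)
  bij_mulA bij_mul1 bij_mulr1 bij_mulV bij_mulVr.

Lemma bij_expE f n x : (f ^+ n)%g x = iter n f x.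
Proof. by elim: n => //= n <-; rewrite expgS. Qed.
End BijectionGroup.

Section Reflection.
Variables (R : realType) (I : Type).
Import Order.TTheory GRing.Theory Num.Theory.
Local Open Scope ring_scope.
(** Dual of the reflection that sends the root r to r - a(s, r) s. *)
Definition coreflect (a : I -> I -> R) (s : I) (phi : I -> R) : I -> R :=
  fun r => phi r - phi s * a s r.

Lemma coreflectK (a : I -> I -> R) s : a s s = 2 -> involutive (coreflect a s).
Proof. by move=> ass phi; apply/funext => r; rewrite /coreflect ass; ring. Qed.

Variables (a : I -> I -> R) (s t : I) (k : R).
Hypotheses (ass : a s s = 2) (att : a t t = 2) (ast : a s t = - k) (ats : a t s = - k).
Let rot (phi : I -> R) := coreflect a s (coreflect a t phi).

Let rot_st j phi :
  iter j rot phi s = chebyshev k j.*2.+1 * phi s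
    - chebyshev k j.*2 * (phi t + k * phi s) /\
  iter j rot phi t = chebyshev k j.*2.+1 * phi t + chebyshev k j.*2 * phi s.
Proof.
elim: j => [|j [IHs IHt]]; first by rewrite chebyshev0 chebyshev1 /=; split; ring.
rewrite doubleS 2!chebyshevSS iterS; set psi := iter j rot phi in IHs IHt *.
rewrite /rot /coreflect ast ats ass att IHs IHt.
by split; ring.
Qed.

Let rot_shift j phi : exists X Y : R,
  forall r, iter j rot phi r = phi r - X * a s r - Y * a t r.
Proof.
elim: j => [|j [X [Y IH]]]; first by exists 0, 0 => r /=; ring.
pose psi := iter j rot phi.
exists (X + coreflect a t psi s), (Y + psi t) => r.
have IHr : psi r = phi r - X * a s r - Y * a t r by exact: IH.
rewrite iterS -/psi /rot {1}/coreflect.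
have -> : coreflect a t psi r = psi r - psi t * a t r by [].
by rewrite IHr; ring.
Qed.

(** The m-th iterate shifts phi by a combination X a(s, .) + Y a(t, .). The Chebyshev values make
    the shift vanish at s and t, and the Gram determinant 4 - k^2 is nonzero, so X = Y = 0. *)
Lemma coreflect_braid m : k ^+ 2 < 4 ->
  chebyshev k m.*2 = 0 -> chebyshev k m.*2.+1 = 1 ->
  forall phi, iter m (coreflect a s \o coreflect a t) phi = phi.
Proof.
move=> k4 c0 c1 phi; have [X [Y XY]] := rot_shift m phi.
have [] := rot_st m phi; rewrite c0 c1 !XY ass ats ast att => es et.
have X2 : 2 * X = k * Y by lra.
have Y2 : 2 * Y = k * X by lra.
have X0 : X = 0.
  have : (4 - k ^+ 2) * X = 0.
    by rewrite mulrBl expr2 -[k * k * X]mulrA -Y2; lra.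
  by move/eqP; rewrite mulf_eq0 subr_eq0 gt_eqF //= => /eqP.
have Y0 : Y = 0 by move: Y2; rewrite X0 mulr0 => /eqP; rewrite mulf_eq0 pnatr_eq0 => /eqP.
by apply/funext => r; rewrite [LHS]XY X0 Y0; ring.
Qed.
End Reflection.

Section GeometricRepresentation.
Variables (R : realType) (W : coxeterSystem).
Import Order.TTheory GRing.Theory Num.Theory.
Local Open Scope classical_set_scope.
Local Open Scope ring_scope.
Local Notation S := (@cox_gens W).

(* The contragredient of the geometric representation: W acts on functions on
   the simple roots, so that phi s is the value of the simple root s at phi and
   positivity on S defines the fundamental chamber. *)
Record georep := GeoRep {
  geocart : W -> W -> R;
  geoact : W -> (W -> R) -> (W -> R);
  geoact1 : forall phi, geoact 1%g phi = phi;
  geoactM : forall x y phi, geoact (x * y)%g phi = geoact x (geoact y phi);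
  geoactS : forall s phi r, S s -> geoact s phi r = phi r - phi s * geocart s r;
  geocart_diag : forall s, S s -> geocart s s = 2;
  geocart_sym : forall s t, S s -> S t -> geocart s t = geocart t s;
  geocart_dihedral : forall s t, S s -> S t -> s <> t ->
    (forall n, (0 < n)%N -> 0 < chebyshev (- geocart s t) n) \/
    exists m, [/\ (0 < m)%N, ((s * t) ^+ m = 1)%g,
      forall n, (0 < n < m)%N -> 0 < chebyshev (- geocart s t) n &
      chebyshev (- geocart s t) m = 0] }.

(** Minus the off-diagonal Cartan entry. The default 2, the limit of 2 cos (pi / m), serves the
    infinite case encoded by 0; its Chebyshev values are n. *)
Definition cox_angle (m : nat) : R :=
  if pselect (1 < m)%N is left m1 then sval (cid (dihedral_numbers R m1)) else 2.

Lemma georep_exists : inhabited georep.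
Proof.
have [m [m1 msym mN1] [gen rel univ]] := cox_system W.
pose a (s t : W) : R := if s == t then 2 else - cox_angle (m s t).
have aD s : a s s = 2 by rewrite /a eqxx.
pose f (s : W) : bijection (W -> R) :=
  Bijection (coreflectK (aD s)) (coreflectK (aD s)).
have asym s t : S s -> S t -> a s t = a t s.
  by move=> Ss St; rewrite /a eq_sym msym.
have [|h hM hS] := univ (bijection (W -> R)) f.
  move=> s t Ss St; apply: bijectionP => phi; rewrite bij_expE.
  have -> : iter (m s t) (f s * f t)%g phi =
    iter (m s t) (coreflect a s \o coreflect a t) phi by [].
  have [<-|st] := eqVneq s t.
    by rewrite m1 //= coreflectK.
  have mst1 := mN1 s t Ss St (elimN eqP st).
  have ast : a s t = - cox_angle (m s t) by rewrite /a (negbTE st).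
  have ats : a t s = - cox_angle (m s t) by rewrite asym in ast.
  case: (posnP (m s t)) => [->//|m0].
  move: ast ats; rewrite /cox_angle; case: pselect => [m1'|]; last by lia.
  case: cid => /= k [k4 _ _ c0 c1] ast ats.
  exact: coreflect_braid ast ats _ k4 c0 c1 _.
have h1 : h 1%g = 1%g.
  by have := hM 1%g 1%g; rewrite mulg1 => /(congr1 (mulg (h 1%g)^-1%g)); rewrite mulKg mulVg.
constructor; apply: (@GeoRep a h) => //.
- by move=> phi; rewrite h1.
- by move=> x y phi; rewrite hM.
- by move=> s phi r Ss; rewrite hS ?in_setE.
move=> s t Ss St /eqP st; rewrite /a (negbTE st) opprK.
have mst1 := mN1 s t Ss St (elimN eqP st).
case: (posnP (m s t)) => [->|m0].
  left=> n n0; rewrite /cox_angle; case: pselect => // _.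
  by rewrite chebyshev2 ltr0n.
right; exists (m s t); rewrite /cox_angle; case: pselect => [m1'|]; last by lia.
by case: cid => /= k [k4 kn km _ _]; split => //; exact: rel.
Qed.
End GeometricRepresentation.

Section Alternating.
Variable W : coxeterSystem.
Local Open Scope group_scope.
Local Notation S := (@cox_gens W).
Local Notation len := (@cox_length W).
Implicit Types (a b s t : W).

Fixpoint alt k a b : W := if k is k'.+1 then a * alt k' b a else 1.

Lemma altSr k a b : alt k.+1 a b = alt k a b * (if odd k then b else a).
Proof.
elim: k a b => [|k IH] a b; first by rewrite /= mulg1 mul1g.
by rewrite [LHS]/= -/(alt k.+1 b a) IH mulgA /= if_neg.
Qed.

Lemma len_alt k a b : S a -> S b -> (len (alt k a b) <= k)%N.
Proof.
elim: k a b => [|k IH] a b Sa Sb /=; first by rewrite len1.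
by apply: leq_trans (len_genM _ Sa) _; rewrite ltnS IH.
Qed.

Lemma altD m n a b :
  alt (m + n) a b = alt m a b * (if odd m then alt n b a else alt n a b).
Proof.
elim: m a b => [|m IH] a b; first by rewrite mul1g.
by rewrite addSn /= IH mulgA if_neg.
Qed.

Lemma alt_double m a b : alt m.*2 a b = (a * b) ^+ m.
Proof. by elim: m => [//|m IH]; rewrite doubleS expgS /= IH mulgA. Qed.

Lemma altV k a b : S a -> S b ->
  (alt k a b)^-1 = if odd k then alt k a b else alt k b a.
Proof.
move=> Sa Sb; elim: k a b Sa Sb => [|k IH] a b Sa Sb; first by rewrite invg1.
rewrite [in LHS]/= invgM IH // gen_inv // !altSr /=.
by case: ifP => /=.
Qed.

Lemma alt_braid m a b : S a -> S b -> (a * b) ^+ m = 1 -> alt m a b = alt m b a.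
Proof.
move=> Sa Sb ab1; rewrite -[RHS]invgK altV //.
have : alt (m + m) a b = 1 by rewrite addnn alt_double.
by rewrite altD => /mulg1_eq E; rewrite -[LHS]invgK E; case: odd.
Qed.
End Alternating.

(** * Signs of roots and length *)

Section RootSigns.
Variables (R : realType) (W : coxeterSystem) (g : georep R W).
Import Order.TTheory GRing.Theory Num.Theory.
Local Open Scope classical_set_scope.
Local Open Scope ring_scope.
Local Notation S := (@cox_gens W).
Local Notation len := (@cox_length W).
Local Notation act := (geoact g).
Local Notation cart := (geocart g).
Implicit Types (phi psi : W -> R) (x y z h s t r : W).

Definition dominant phi := forall s, S s -> 0 < phi s.

Lemma dominant1 : dominant (fun=> 1). Proof. by move=> s _. Qed.

Lemma act_linear x (c : R) phi psi r :
  act x (fun w => phi w + c * psi w) r = act x phi r + c * act x psi r.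
Proof.
have [d [Sd <- _]] := reduced_word x.
elim: d Sd phi psi r => [|s d IH] Sd phi psi r; first by rewrite big_nil !geoact1.
have Ss : S s by apply: Sd; rewrite inE eqxx.
have Sd' q : q \in d -> S q by move=> qd; apply: Sd; rewrite inE qd orbT.
by rewrite big_cons !geoactM !(geoactS g _ _ Ss) !IH //; ring.
Qed.

Lemma alt_value k s t psi : S s -> S t ->
  act (alt k s t) psi t =
    chebyshev (- cart s t) k.+1 * psi (if odd k then s else t) +
    chebyshev (- cart s t) k * psi (if odd k then t else s).
Proof.
pose P k := forall s t, S s -> S t -> act (alt k s t) psi t =
    chebyshev (- cart s t) k.+1 * psi (if odd k then s else t) +
    chebyshev (- cart s t) k * psi (if odd k then t else s).
suff [+ _] : P k /\ P k.+1 by apply.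
elim: k {s t} => [|k [IH1 IH2]].
  split=> s t Ss St; first by rewrite geoact1 chebyshev0 chebyshev1 /=; ring.
  by rewrite /= mulg1 geoactS // chebyshevSS chebyshev0 chebyshev1; ring.
split=> // s t Ss St; rewrite [alt _ _ _]/= -/(alt k.+1 t s) geoactM geoactS //.
rewrite (IH2 t s) // [alt k.+1 t s]/= geoactM geoactS // (IH1 s t) // geocart_diag //.
rewrite !chebyshevSS (geocart_sym _ St Ss) /=.
by case: (odd k) => /=; ring.
Qed.

(** Positivity of the root x^-1 s. Split off the longest alternating prefix of x in a left descent r
    and s; for the remaining factor y the roots y^-1 r and y^-1 s are positive by induction, and the
    prefix combines them with nonnegative coefficients. *)
Lemma act_pos x s phi : S s -> (len x < len (s * x)%g)%N -> dominant phi ->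
  0 < act x phi s.
Proof.
move=> Ss + phi0; have [n] := ubnP (len x); elim: n => // n IH in x s Ss *.
move=> xn xs; have [->|/eqP x1] := eqVneq x 1%g; first by rewrite geoact1 phi0.
have [r Sr rx] := left_descent x1.
have rs : r <> s by move=> E; rewrite E in rx; lia.
pose Q k := `[< exists y, x = (alt k r s * y)%g /\ len x = (k + len y)%N >].
have Q1 : exists k, Q k.
  exists 1%N; apply/asboolP; exists (r * x)%g; rewrite /= mulg1 genK //.
  by rewrite add1n -(len_down Sr rx).
have Qb k : Q k -> (k <= len x)%N by move=> /asboolP [y [_ ->]]; lia.
case: (ex_maxnP Q1 Qb) => k /asboolP [y [xy lxy]] kmax.
have k0 : (0 < k)%N.
  apply: kmax; apply/asboolP; exists (r * x)%g; rewrite /= mulg1 genK //.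
  by rewrite add1n -(len_down Sr rx).
(* A descent of y at the next letter would lengthen the prefix; in [prev], one at the last letter
   would shorten x. *)
have next z : z = (if odd k then s else r) -> S z -> (len y < len (z * y)%g)%N.
  move=> zE Sz; case: (gen_ltP y Sz) => // zy.
  suff : (k.+1 <= k)%N by rewrite ltnn.
  apply: kmax; apply/asboolP; exists (z * y)%g.
  split; first by rewrite altSr -zE mulgA mulgenK.
  by rewrite lxy (len_down Sz zy); lia.
have prev z : z = (if odd k then r else s) -> S z -> (len y < len (z * y)%g)%N.
  move=> zE Sz; case: (gen_ltP y Sz) => // zy.
  have xE : x = (alt k.-1 r s * (z * y))%g.
    rewrite xy -{1}(prednK k0) altSr -mulgA; congr (_ * (_ * _))%g.
    by rewrite zE -{2}(prednK k0) /=; case: odd.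
  have := lenM (alt k.-1 r s) (z * y)%g; rewrite -xE.
  by have := len_alt k.-1 Sr Ss; lia.
have yr : (len y < len (r * y)%g)%N.
  by have := next r; have := prev r; case: odd => H1 H2; [exact: H1|exact: H2].
have ys : (len y < len (s * y)%g)%N.
  by have := next s; have := prev s; case: odd => H1 H2; [exact: H2|exact: H1].
have yn : (len y < n)%N by lia.
have psir := IH y r Sr yn yr; have psis := IH y s Ss yn ys.
rewrite xy geoactM alt_value //.
case: (geocart_dihedral g Sr Ss rs) => [cp|[m [m0 mrs cp cm]]].
  by apply: addr_gt0; apply: mulr_gt0; [exact: cp|case: ifP|exact: cp|case: ifP].
(* For k >= m the braid relation would let a reduced expression of x start with s. *)
have km : (k < m)%N.
  rewrite ltnNge; apply/negP => mk.
  have xE : (s * x = alt m.-1 r s * ((if odd m then alt (k - m) s r else alt (k - m) r s) * y))%g.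
    rewrite xy -{1}(subnKC mk) altD (alt_braid Sr Ss mrs) -{1}(prednK m0) /=.
    by rewrite !mulgA gen_sq // mul1g.
  have := lenM (alt m.-1 r s) ((if odd m then alt (k - m) s r else alt (k - m) r s) * y)%g.
  rewrite -xE; have := lenM (if odd m then alt (k - m) s r else alt (k - m) r s) y.
  have := len_alt m.-1 Sr Ss; have := len_alt (k - m) Sr Ss; have := len_alt (k - m) Ss Sr.
  by case: odd; lia.
apply: ltr_wpDl; last by apply: mulr_gt0; [apply: cp; rewrite k0|case: ifP].
apply: mulr_ge0; last by case: ifP => _; exact: ltW.
have [->|km'] := eqVneq k.+1 m; first by rewrite cm.
by apply/ltW/cp; lia.
Qed.

Lemma act_neg x s phi : S s -> (len (s * x)%g < len x)%N -> dominant phi ->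
  act x phi s < 0.
Proof.
move=> Ss sx phi0; have := @act_pos (s * x)%g s phi Ss; rewrite genK // => /(_ sx phi0).
by rewrite geoactM geoactS // geocart_diag //; lra.
Qed.

(** A left descent of x would make a coordinate negative. Identities between group elements are
    derived from this. *)
Lemma act_dominant x phi : dominant phi -> dominant (act x phi) -> x = 1%g.
Proof.
move=> phi0 xphi; apply: contrapT => x1; have [s Ss sx] := left_descent x1.
by have := act_neg Ss sx phi0; have := xphi s Ss; lra.
Qed.

Lemma act_conj h s phi r : S s ->
  act (h * s * h^-1)%g phi r = phi r - act h^-1%g phi s * act h (cart s) r.
Proof.
move=> Ss; rewrite !geoactM.
have -> : act s (act h^-1%g phi) =
    (fun w => act h^-1%g phi w + (- act h^-1%g phi s) * cart s w).
  by apply/funext => w; rewrite geoactS //; ring.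
by rewrite act_linear -geoactM mulgV geoact1; ring.
Qed.

(* If the root x^-1 s is proportional to the simple root r, then the product of
   the two reflections is a transvection along r, which moves some dominant
   point to a dominant point. *)
Lemma proportional_root x s r (c : R) : S s -> S r ->
  (forall phi, act x phi s = c * phi r) -> (x^-1 * s * x)%g = r.
Proof.
move=> Ss Sr xs; pose b := act x^-1%g (cart s).
have tE phi w : act (x^-1 * s * x)%g phi w = phi w - c * phi r * b w.
  by have := act_conj x^-1%g phi w Ss; rewrite invgK xs.
have cb : c * b r = 2 by rewrite -xs /b -geoactM mulgV geoact1 geocart_diag.
pose n w := c * b w - cart r w.
have nr : n r = 0 by rewrite /n cb geocart_diag // subrr.
pose phi w : R := if w == r then 1 else 1 + `|n w|.
have trE w : act (x^-1 * s * x * r)%g phi w = phi w + phi r * n w.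
  by rewrite geoactM tE !geoactS // geocart_diag // /n; ring.
have phir : phi r = 1 by rewrite /phi eqxx.
suff : (x^-1 * s * x * r)%g = 1%g by move/mulg1_eq => E; rewrite -[LHS]invgK E gen_inv.
apply: (@act_dominant _ phi) => w Sw.
  by rewrite /phi; case: ifP => // _; rewrite ltr_pwDl.
rewrite trE phir mul1r /phi; case: eqVneq => [->|_]; first by rewrite nr addr0.
by have := ler_norm (- n w); rewrite normrN; lra.
Qed.

Lemma perturb_ge0 (c d : R) : (forall e, 0 < e -> 0 < c + e * d) -> 0 <= c.
Proof.
move=> cd; rewrite leNgt; apply/negP => c0.
have [d0|d0] := leP d 0; first by have := cd 1 ltr01; rewrite mul1r; lra.
have e0 : 0 < - c / d by rewrite divr_gt0 // oppr_gt0.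
by have := cd _ e0; rewrite divfK ?gt_eqF // subrr ltxx.
Qed.

(** The root x^-1 s is positive and its image under r is negative. A point with nonnegative
    coordinates and phi r = 0 is fixed by r, so the root vanishes there, as perturbation by the
    constant 1 shows. Hence the root is a multiple of r, and [proportional_root] applies. *)
Lemma reflect_sign x s r : S s -> S r ->
  (len x < len (s * x)%g)%N -> (len (s * (x * r))%g < len (x * r)%g)%N ->
  (x^-1 * s * x)%g = r.
Proof.
move=> Ss Sr sx sxr.
have nonneg0 phi : (forall w, 0 <= phi w) -> phi r = 0 -> act x phi s = 0.
  move=> phi0 phir; pose p (e : R) w : R := phi w + e * 1.
  have pdom e : 0 < e -> dominant (p e) by move=> e0 w _; rewrite /p mulr1 ltr_wpDl.
  have lo e : 0 < e -> 0 < act x phi s + e * act x (fun=> 1) s.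
    by move=> /pdom /(act_pos Ss sx); rewrite act_linear.
  have hi e : 0 < e -> act x phi s + e * act (x * r)%g (fun=> 1) s < 0.
    move=> /pdom /(act_neg Ss sxr); rewrite geoactM.
    rewrite (_ : act r (p e) = fun w => phi w + e * act r (fun=> 1) w) ?act_linear.
      by rewrite -geoactM.
    by apply/funext => w; rewrite !geoactS // /p phir; ring.
  have ge0 := perturb_ge0 lo; suff : 0 <= - act x phi s by lra.
  apply: (@perturb_ge0 _ (- act (x * r)%g (fun=> 1) s)) => e /hi.
  by rewrite mulrN; lra.
pose delta w : R := (w == r)%:R.
apply: (@proportional_root x s r (act x delta s)) => // phi.
pose phi0 w := phi w + (- phi r) * delta w.
have phi0r : phi0 r = 0 by rewrite /phi0 /delta eqxx mulr1 subrr.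
pose pp w := Num.max (phi0 w) 0; pose pn w := Num.max (- phi0 w) 0.
have : act x (fun w => pp w + (-1) * pn w) s = 0.
  rewrite act_linear !nonneg0 ?mulr0 ?addr0 //.
  - by move=> w; rewrite /pn le_max lexx orbT.
  - by rewrite /pn phi0r oppr0 maxxx.
  - by move=> w; rewrite /pp le_max lexx orbT.
  - by rewrite /pp phi0r maxxx.
have -> : (fun w => pp w + (-1) * pn w) = phi0.
  apply/funext => w; rewrite /pp /pn; case: (leP (phi0 w) 0) => h0.
    by rewrite max_l ?oppr_ge0 //; ring.
  by rewrite max_r ?oppr_le0 ?(ltW h0) //; ring.
by rewrite /phi0 act_linear => E; lra.
Qed.

(** Both sides are the bilinear form at the roots x s and r; this is its symmetry and invariance
    under W. *)
Lemma act_cart_sym x s r : S s -> S r -> act x (cart s) r = act x^-1%g (cart r) s.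
Proof.
have [d [Sd <- _]] := reduced_word x.
elim: d Sd s r => [|a d IH] Sd s r Ss Sr.
  by rewrite big_nil invg1 !geoact1 geocart_sym.
have Sa : S a by apply: Sd; rewrite inE eqxx.
have Sd' q : q \in d -> S q by move=> qd; apply: Sd; rewrite inE qd orbT.
rewrite big_cons invgM !geoactM (geoactS g _ _ Sa) (gen_inv Sa) !IH //.
have -> : act a (cart r) = fun w => cart r w + (- cart r a) * cart a w.
  by apply/funext => w; rewrite geoactS //; ring.
by rewrite act_linear (geocart_sym _ Sa Sr); ring.
Qed.
End RootSigns.

(** * Length comparison under reflections *)

Section ReflectionLength.
Variable W : coxeterSystem.
Import Order.TTheory GRing.Theory Num.Theory.
Local Open Scope group_scope.
Local Notation S := (@cox_gens W).
Local Notation T := (@reflections W).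
Local Notation len := (@cox_length W).
Implicit Types (x y z h s t r p q : W).

Lemma commute_descent x s r : S s -> S r ->
  (len x < len (s * x))%N -> (len (s * (x * r)) < len (x * r))%N ->
  x^-1 * s * x = r.
Proof. by case: (georep_exists Rdefinitions.R W) => g; exact: (reflect_sign g). Qed.

(** Replacing h by h s negates the root h s, so one of the two choices makes it positive. *)
Lemma refl_positive t : T t ->
  exists h s, [/\ S s, t = h * s * h^-1 & (len h^-1 < len (s * h^-1))%N].
Proof.
move=> [h [s [Ss ->]]]; case: (gen_ltP h^-1 Ss) => lt; first by exists h, s.
exists (h * s), s; rewrite invgM (gen_inv Ss) (genK _ Ss); split=> //.
by rewrite !mulgA (mulgenK _ Ss).
Qed.

(** In terms of roots, the right side says that x^-1 keeps the positive root of t = h s h^-1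
    positive. The induction follows left descents r: unless t = r, conjugation by r keeps the root
    of t positive. *)
Lemma refl_len_lt h s x : S s -> (len h^-1 < len (s * h^-1))%N ->
  (len x < len (h * s * h^-1 * x))%N <-> (len (h^-1 * x) < len (s * (h^-1 * x)))%N.
Proof.
have key h' s' y : S s' -> (len h'^-1 < len (s' * h'^-1))%N ->
    (len (s' * (h'^-1 * y)) < len (h'^-1 * y))%N -> (len (h' * s' * h'^-1 * y) < len y)%N.
  move=> {h s x} Ss; have [n] := ubnP (len y); elim: n => // n IH in y h' *.
  move=> yn hpos hy; have [y1|/eqP y1] := eqVneq y 1.
    by move: hy; rewrite y1 mulg1; lia.
  have [r Sr ry] := left_descent y1.
  have [tr|/eqP tr] := eqVneq (h' * s' * h'^-1) r; first by rewrite tr.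
  have rh : (r * h')^-1 = h'^-1 * r by rewrite invgM (gen_inv Sr).
  have pos : (len (r * h')^-1 < len (s' * (r * h')^-1))%N.
    rewrite rh; case: (gen_ltP (h'^-1 * r) Ss) => // neg.
    by case: tr; have := commute_descent Ss Sr hpos neg; rewrite invgK.
  have ryn : (len (r * y) < n)%N by lia.
  have rhy : (r * h')^-1 * (r * y) = h'^-1 * y by rewrite rh -mulgA (genK _ Sr).
  have := IH (r * y) (r * h') ryn pos; rewrite rhy => /(_ hy).
  have -> : r * h' * s' * (r * h')^-1 * (r * y) = r * (h' * s' * h'^-1 * y).
    by rewrite rh !mulgA -[_ * r * r]mulgA (gen_sq Sr) mulg1.
  have := len_genMge (h' * s' * h'^-1 * y) Sr.
  by have := len_genMge y Sr; lia.
move=> Ss pos; split=> lt.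
  by case: (gen_ltP (h^-1 * x) Ss) => // /(key _ _ _ Ss pos); lia.
have := key h s (h * s * h^-1 * x) Ss pos.
have -> : h^-1 * (h * s * h^-1 * x) = s * (h^-1 * x) by rewrite !mulgA mulVg mul1g.
rewrite (genK _ Ss) => /(_ lt).
have -> // : h * s * h^-1 * (h * s * h^-1 * x) = x.
by rewrite reflK //; exists h, s.
Qed.

(** The reflection z t z^-1 takes z p to z t p. Its root, the image under z of that of t, is
    positive since z t > z, and (z p)^-1 sends it to the image under p^-1 of the root of t, positive
    since t p > p. *)
Lemma refl_mul_len_lt t z p : T t -> (len z < len (z * t))%N ->
  (len p < len (t * p))%N -> (len (z * p) < len (z * (t * p)))%N.
Proof.
move=> Tt zt; have [h [s [Ss tE pos]]] := refl_positive Tt.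
rewrite {1}tE => /(refl_len_lt _ Ss pos) hp.
have zpos : (len (z * h)^-1 < len (s * (z * h)^-1))%N.
  rewrite invgM; apply/(refl_len_lt _ Ss pos); rewrite -tE lenV.
  by rewrite -[t]refl_inv // -invgM lenV.
have -> : z * (t * p) = z * h * s * (z * h)^-1 * (z * p).
  by rewrite invgM tE !mulgA -[_ * z^-1 * z]mulgA mulVg mulg1.
apply/(refl_len_lt _ Ss zpos); rewrite invgM.
by have -> : h^-1 * z^-1 * (z * p) = h^-1 * p by rewrite !mulgA -[_ * z^-1 * z]mulgA mulVg mulg1.
Qed.

(* At the point z^-1 1 the roots of [r] and [r * rho * r] are positive and that of
   [rho] is negative, which forces the root of [rho] to be negative at the simple
   coroot of [r]. *)
Lemma refl_gen_len_lt z r rho : S r -> T rho -> (len z < len (z * r))%N ->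
  (len z < len (z * (r * rho * r)))%N -> (len (z * rho) < len z)%N ->
  (len rho < len (rho * r))%N.
Proof.
move=> Sr Trho zr zrr zrho.
have [h [s [Ss rE pos]]] := refl_positive Trho.
case: (georep_exists Rdefinitions.R W) => g.
pose one (w : W) : Rdefinitions.R := 1%R; have dom : dominant one := @dominant1 _ W.
pose psi := geoact g z^-1 one.
have psir : (0 < psi r)%R.
  by apply: (act_pos g Sr _ dom); rewrite -(gen_inv Sr) -invgM !lenV.
have mpsi : (geoact g h^-1 psi s < 0)%R.
  rewrite /psi -geoactM; apply: (act_neg g Ss _ dom).
  case: (gen_ltP (h^-1 * z^-1) Ss) => // /(refl_len_lt _ Ss pos); rewrite -rE lenV.
  by rewrite -(lenV (rho * z^-1)) invgM invgK (refl_inv Trho) ltnNge ltnW.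
have rpos : (len (r * h)^-1 < len (s * (r * h)^-1))%N.
  rewrite invgM (gen_inv Sr); case: (gen_ltP (h^-1 * r) Ss) => // lt.
  have := commute_descent Ss Sr pos lt; rewrite invgK -rE => E.
  by move: zrho; rewrite E; lia.
have mrpsi : (0 < geoact g h^-1 (geoact g r psi) s)%R.
  have rh : (r * h)^-1 = h^-1 * r by rewrite invgM (gen_inv Sr).
  rewrite /psi -!geoactM -?mulgA [h^-1 * (r * _)]mulgA -rh.
  apply: (act_pos g Ss _ dom); apply/(refl_len_lt _ Ss rpos).
  have -> : r * h * s * (r * h)^-1 = (r * rho * r)^-1.
    by rewrite (refl_inv (refl_conj_gen Sr Trho)) rh rE !mulgA.
  by rewrite -invgM !lenV.
have mr : (geoact g h^-1 (geocart g r) s < 0)%R.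
  have E : geoact g r psi = (fun w => psi w + (- psi r) * geocart g r w)%R.
    by apply/funext => w; rewrite (geoactS g _ _ Sr); ring.
  move: mrpsi; rewrite E act_linear => mrpsi; rewrite ltNge; apply/negP => h0.
  have := mulr_ge0 (ltW psir) h0; lra.
have m1 : (0 < geoact g h^-1 one s)%R by exact: (act_pos g Ss pos dom).
have rr : (0 < geoact g rho one r)%R.
  rewrite rE (act_conj g _ _ _ Ss) (act_cart_sym g _ Ss Sr) /one.
  have mr' : (0 < - geoact g h^-1 (geocart g r) s)%R by rewrite oppr_gt0.
  by have := mulr_gt0 m1 mr'; rewrite /one; lra.
rewrite -lenV -[len (_ * _)]lenV invgM (refl_inv Trho) (gen_inv Sr).
case: (gen_ltP rho Sr) => // /(act_neg g Sr) /(_ dom) neg.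
by have := lt_trans rr neg; rewrite ltxx.
Qed.
End ReflectionLength.

(** * Bruhat order *)

Section BruhatOrder.
Variable W : coxeterSystem.
Local Open Scope group_scope.
Local Notation S := (@cox_gens W).
Local Notation T := (@reflections W).
Local Notation len := (@cox_length W).
Local Notation le := (@bruhat_le W).
Local Notation edge := (@bruhat_edge W).
Implicit Types (x y z s t r p q u v w : W).

(** Unoriented Bruhat edges: unlike the length comparison, this relation is invariant under left
    multiplication. *)
Definition adjacent x y := exists2 t, T t & y = t * x.

Lemma adjacent_sym x y : adjacent x y -> adjacent y x.
Proof. by move=> [t Tt ->]; exists t => //; rewrite reflK. Qed.

Lemma adjacent_gen s x : S s -> adjacent x (s * x).
Proof. by move=> /refl_gen Ts; exists s. Qed.

Lemma adjacent_mull z x y : adjacent x y -> adjacent (z * x) (z * y).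
Proof.
move=> [t Tt ->]; exists (z * t * z^-1); first exact: refl_conj.
by rewrite !mulgA mulgKV.
Qed.

Lemma bruhat_refl x : le x x. Proof. exact: rt_refl. Qed.
Lemma bruhat_trans y x z : le x y -> le y z -> le x z. Proof. exact: rt_trans. Qed.
Lemma edge_le x y : edge x y -> le x y. Proof. exact: rt_step. Qed.
Lemma le_gen s x : S s -> (len x < len (s * x))%N -> le x (s * x).
Proof. by move=> Ss lt; apply: edge_le; split=> //; exact: adjacent_gen. Qed.

Lemma le_gen_down s x : S s -> (len (s * x) < len x)%N -> le (s * x) x.
Proof. by move=> Ss; rewrite -{2 4}(genK x Ss); exact: le_gen. Qed.

Lemma le_len_eq x y : le x y -> x = y \/ (len x < len y)%N.
Proof.
elim=> [a b [_ lt]|a|a b c _ + _]; [by right|by left|].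
by case=> [->|ab] // [<-|bc]; right => //; exact: ltn_trans ab bc.
Qed.

Lemma le_len x y : le x y -> (len x <= len y)%N.
Proof. by move=> /le_len_eq [->|/ltnW]. Qed.

Lemma le_lt_len x y : le x y -> x <> y -> (len x < len y)%N.
Proof. by move=> /le_len_eq []. Qed.

Lemma le_edge x y : le x y -> len y = (len x).+1 -> edge x y.
Proof.
move=> xy; case: (clos_rt_rt1n _ _ _ _ xy) => [|b c [[t Tt bE] lt] bc lc]; first by lia.
have {}bc := clos_rt1n_rt _ _ _ _ bc.
have [<-|] := le_len_eq bc; last by lia.
by split=> //; exists t.
Qed.

Lemma len_gen_refl_gt s t : S s -> T t -> t <> s -> (len s < len (s * t))%N.
Proof.
move=> Ss Tt ts; rewrite (len_gen Ss).
have := odd_len_reflM s (refl_gen Ss); have := odd_lenM s t.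
rewrite (odd_len_refl (refl_gen Ss)) (odd_len_refl Tt) /=.
case E: (len (s * t)) => [|[|]] // _ _; case: ts.
by have /mulg1_eq := len_eq0 E; rewrite gen_inv.
Qed.

Lemma len_refl_gen_gt s t : S s -> T t -> t <> s -> (len s < len (t * s))%N.
Proof.
move=> Ss Tt ts; have := len_gen_refl_gt Ss Tt ts.
by rewrite -[len (t * s)]lenV invgM (refl_inv Tt) (gen_inv Ss).
Qed.

Lemma gen_refl_len_lt s t x : S s -> T t -> t <> s -> (len x < len (t * x))%N ->
  (len (s * x) < len (s * (t * x)))%N.
Proof. by move=> Ss Tt ts; apply: refl_mul_len_lt => //; exact: len_gen_refl_gt. Qed.

Lemma edge_gen s x y : S s -> edge x y -> y = s * x \/ edge (s * x) (s * y).
Proof.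
move=> Ss [[t Tt ->] lt]; have [->|/eqP ts] := eqVneq t s; first by left.
right; split; last exact: gen_refl_len_lt.
by apply: adjacent_mull; exists t.
Qed.

(** Lifting property, followed along a chain of edges: an edge either survives multiplication by s
    or is itself multiplication by s. *)
Lemma le_gen_or s x y : S s -> le x y -> le (s * x) (s * y) \/ le (s * x) y.
Proof.
move=> Ss xy; elim: (clos_rt_rtn1 _ _ _ _ xy) => [|b c bc _ IH]; first by left; exact: bruhat_refl.
case: IH => H; last by right; apply: bruhat_trans H (edge_le bc).
case: (edge_gen Ss bc) => [->|/edge_le bc']; first by right.
by left; exact: bruhat_trans H bc'.
Qed.

Lemma le_or_gen s x y : S s -> le x y -> le (s * x) (s * y) \/ le x (s * y).
Proof.
move=> Ss xy; elim: (clos_rt_rt1n _ _ _ _ xy) => [a|a b c ab _ IH]; first by left; exact: bruhat_refl.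
case: IH => H; last by right; apply: bruhat_trans (edge_le ab) H.
case: (edge_gen Ss ab) => [E|/edge_le ab']; last by left; exact: bruhat_trans ab' H.
by right; move: H; rewrite E genK.
Qed.

Lemma le_gen_l s x y : S s -> (len (s * y) < len y)%N -> le x y -> le (s * x) y.
Proof.
by move=> Ss /(le_gen_down Ss) sy /(le_gen_or Ss) [/bruhat_trans|//]; apply.
Qed.

Lemma le_gen_r s x y : S s -> (len x < len (s * x))%N -> le x y -> le x (s * y).
Proof.
by move=> Ss /(le_gen Ss) sx /(le_or_gen Ss) [|//]; exact: bruhat_trans.
Qed.

Lemma le_gen_lr_down s x y : S s -> (len (s * x) < len x)%N -> le x y ->
  le (s * x) (s * y).
Proof.
move=> Ss sx xy; apply: le_gen_r => //; first by rewrite genK.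
exact: bruhat_trans (le_gen_down Ss sx) xy.
Qed.

Lemma le_gen_lr_up s x y : S s -> (len y < len (s * y))%N -> le x y ->
  le (s * x) (s * y).
Proof.
move=> Ss sy xy; apply: le_gen_l => //; first by rewrite genK.
exact: bruhat_trans xy (le_gen Ss sy).
Qed.

End BruhatOrder.

(** * Length-additive left factors *)

Section Additive.
Variable W : coxeterSystem.
Local Open Scope group_scope.
Local Notation S := (@cox_gens W).
Local Notation T := (@reflections W).
Local Notation len := (@cox_length W).
Local Notation le := (@bruhat_le W).
Local Notation edge := (@bruhat_edge W).
Implicit Types (x y z s t r p q u v w : W).

Definition reduced z x := len (z * x) = (len z + len x)%N.

Lemma reduced1 x : reduced 1 x.
Proof. by rewrite /reduced mul1g len1. Qed.

Lemma reduced_up z x t : reduced z x -> T t -> (len z < len (z * t))%N ->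
  len (t * x) = (len x).+1 -> reduced z (t * x).
Proof.
move=> zx Tt zt tx; have := refl_mul_len_lt Tt zt (_ : (len x < len (t * x))%N).
by have := lenM z (t * x); rewrite /reduced in zx *; lia.
Qed.

Lemma reduced_gen_up z x s : reduced z x -> S s -> (len z < len (z * s))%N ->
  (len x < len (s * x))%N -> reduced z (s * x).
Proof. by move=> zx Ss zs /(len_up Ss); apply: reduced_up (refl_gen Ss) _. Qed.

Lemma reduced_shift z x s : reduced z x -> S s -> (len (s * x) < len x)%N ->
  (len z < len (z * s))%N /\ reduced (z * s) (s * x).
Proof.
rewrite /reduced => zx Ss sx; have := lenM (z * s) (s * x).
have zE : z * s * (s * x) = z * x by rewrite -mulgA genK.
rewrite zE; have := len_down Ss sx; have := lenM z s; rewrite (len_gen Ss); lia.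
Qed.

Lemma reduced_unshift z x s : reduced z x -> S s -> (len (z * s) < len z)%N ->
  (len x < len (s * x))%N /\ reduced (z * s) (s * x).
Proof.
rewrite /reduced => zx Ss zs; have := lenM (z * s) (s * x).
have zE : z * s * (s * x) = z * x by rewrite -mulgA genK.
rewrite zE; have := len_genM x Ss; have := lenM (z * s) s.
by rewrite mulgenK // (len_gen Ss); lia.
Qed.

Lemma reduced_gen_unshift z x s : reduced (z * s) x -> S s ->
  (len z < len (z * s))%N -> (len x < len (s * x))%N /\ reduced z (s * x).
Proof.
move=> zx Ss zs; have := reduced_unshift zx Ss; rewrite mulgenK //.
by apply.
Qed.

Lemma reduced_refl z x t : reduced z x -> T t -> (len (z * t) < len z)%N ->
  (len x < len (t * x))%N.
Proof.
rewrite /reduced => zx Tt zt; case: (refl_ltP x Tt) => // tx.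
have := lenM (z * t) (t * x).
have -> : z * t * (t * x) = z * x by rewrite -mulgA reflK.
by lia.
Qed.

Lemma reduced_ind (P : W -> Prop) : P 1 ->
  (forall z s, S s -> (len z < len (z * s))%N -> P z -> P (z * s)) -> forall z, P z.
Proof.
move=> P1 PS z; have [n] := ubnP (len z); elim: n => // n IH in z *.
move=> zn; have [->//|/eqP z1] := eqVneq z 1.
have [s Ss zs] := right_descent z1; rewrite -(mulgenK z Ss).
by apply: PS; rewrite ?mulgenK //; apply: IH; lia.
Qed.

Lemma reduced_le z p q : reduced z q -> le p q -> le (z * p) (z * q).
Proof.
elim/reduced_ind: z p q => [|z s Ss zs IH] p q zq pq; first by rewrite !mul1g.
have [sq zsq] := reduced_gen_unshift zq Ss zs; rewrite -!mulgA.
by apply: IH => //; exact: le_gen_lr_up.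
Qed.

(** Additivity is required of the lower product only: each letter of z raises p, and the lifting
    property then removes it from the upper side. *)
Lemma reduced_le_cancel z p x : reduced z p -> le (z * p) (z * x) -> le p x.
Proof.
elim/reduced_ind: z p x => [|z s Ss zs IH] p x zp; first by rewrite !mul1g.
have [sp zsp] := reduced_gen_unshift zp Ss zs; rewrite -!mulgA => /(IH _ _ zsp) sx.
by rewrite -(genK x Ss); apply: le_gen_r => //; exact: bruhat_trans (le_gen Ss sp) sx.
Qed.

(** For a left descent s of q, either t = s works, or the reflection found for z s, s p, s q is
    conjugated by s. The condition z < z t ensures that z t p is additive whenever z p is. *)
Lemma reduced_cover z p q : reduced z q -> le p q -> p <> q ->
  exists t, [/\ T t, (len z < len (z * t))%N, len (t * p) = (len p).+1 & le (t * p) q].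
Proof.
have [n] := ubnP (len q); elim: n => // n IH in z p q *; move=> qn zq pq npq.
have q1 : q <> 1 by move=> E; have := le_lt_len pq npq; rewrite E len1.
have [s Ss sq] := left_descent q1; have [zs zsq] := reduced_shift zq Ss sq.
case: (gen_ltP p Ss) => sp.
  by exists s; rewrite (len_up Ss sp); split=> //; [exact: refl_gen|exact: le_gen_l].
have [||||t [Tt zst tsp tspq]] := IH (z * s) (s * p) (s * q) => //.
- by lia.
- exact: le_gen_lr_down.
- by move=> E; apply: npq; rewrite -(genK p Ss) E genK.
have ts : t <> s by move=> E; move: zst; rewrite E (mulgenK _ Ss); lia.
have tp : s * t * s * p = s * (t * (s * p)) by rewrite !mulgA.
have up : (len p < len (s * (t * (s * p))))%N.
  have := @gen_refl_len_lt _ s t (s * p) Ss Tt ts; rewrite (genK _ Ss) tsp.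
  by apply.
exists (s * t * s); split; first exact: refl_conj_gen.
- have := refl_mul_len_lt Tt zst (len_refl_gen_gt Ss Tt ts).
  by rewrite (mulgenK _ Ss) !mulgA.
- rewrite tp; have := len_genM (t * (s * p)) Ss.
  by have := len_down Ss sp; lia.
- by rewrite tp; apply: le_gen_l => //; apply: bruhat_trans tspq (le_gen_down Ss sq).
Qed.

Lemma reduced_base x y : le x y -> x <> y -> exists z u w r,
  [/\ x = z * u /\ y = z * w, reduced z u /\ reduced z w, S r,
      (len u < len (r * u))%N /\ (len (r * w) < len w)%N & le u w].
Proof.
have [n] := ubnP (len y); elim: n => // n IH in x y *; move=> yn xy nxy.
have y1 : y <> 1 by move=> E; have := le_lt_len xy nxy; rewrite E len1.
have [s Ss sy] := left_descent y1; case: (gen_ltP x Ss) => sx.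
  exists 1, x, y, s; rewrite !mul1g; split=> //; split; exact: reduced1.
have [|||z [u [w [r [[xE yE] [zu zw] Sr [ru rw] uw]]]]] := IH (s * x) (s * y).
- by lia.
- exact: le_gen_lr_down.
- by move=> E; apply: nxy; rewrite -(genK x Ss) E genK.
have xE' : x = s * z * u by rewrite -mulgA -xE genK.
have yE' : y = s * z * w by rewrite -mulgA -yE genK.
exists (s * z), u, w, r; split=> //; rewrite /reduced -xE' -yE' in zu zw *.
rewrite -xE in zu; rewrite -yE in zw; have := lenM (s * z) u; rewrite -xE'.
have := len_down Ss sx; have := len_down Ss sy; have := len_genM z Ss; lia.
Qed.

Lemma refl_mul_ltP z t : T t -> (len z < len (z * t))%N \/ (len (z * t) < len z)%N.
Proof.
move=> Tt; have [|zt|E] := ltngtP (len z) (len (z * t)); [by left|by right|].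
by have := odd_lenM z t; rewrite -E (odd_len_refl Tt) addbT; case: (odd _).
Qed.

Lemma len_mul_iff z t p : T t -> (len (z * p) < len (z * (t * p)))%N ->
  (len z < len (z * t))%N <-> (len p < len (t * p))%N.
Proof.
move=> Tt lt; split=> lt'.
  case: (refl_ltP p Tt) => // tp.
  have := @refl_mul_len_lt _ t z (t * p) Tt lt'; rewrite reflK // => /(_ tp) lt2.
  by have := ltn_trans lt lt2; rewrite ltnn.
case: (refl_mul_ltP z Tt) => // zt.
have := @refl_mul_len_lt _ t (z * t) p Tt.
rewrite -!mulgA reflK // (refl_sq Tt) mulg1 => /(_ zt lt') lt2.
by have := ltn_trans lt lt2; rewrite ltnn.
Qed.

(* Completes the path z r u, z u, z s u to a four-cycle of the Bruhat graph that
   stays below z w. *)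
Lemma reduced_square z u r s : reduced z u -> S r -> (len u < len (r * u))%N ->
  (len z < len (z * r))%N -> T s -> s <> r ->
  (len (z * u) < len (z * (s * u)))%N ->
  exists q, [/\ (len (z * (r * u)) < len (z * q))%N, adjacent (r * u) q,
    adjacent (s * u) q &
    forall w, (len (r * w) < len w)%N -> le (r * (s * u)) w -> le q w].
Proof.
move=> zu Sr ru zr Ts sr lt.
have [zs us] : (len z < len (z * s))%N /\ (len u < len (s * u))%N.
  case: (refl_mul_ltP z Ts) => zs; first by rewrite -(len_mul_iff Ts lt).
  have us := reduced_refl zu Ts zs; split=> //; exact/(len_mul_iff Ts lt).
pose t := r * s * r; have Tt : T t by exact: refl_conj_gen.
have tr : t <> r.
  by move=> /(congr1 (mulg r)); rewrite /t -mulgA genK // gen_sq // => /mulg1_eq; rewrite refl_inv.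
have st : s = r * t * r by rewrite /t !mulgA gen_sq // mul1g mulgenK.
have rtu : t * (r * u) = r * (s * u) by rewrite /t -mulgA genK // mulgA.
(* The fourth vertex is r s u if z t > z, and s r u otherwise. *)
case: (refl_mul_ltP z Tt) => zt.
  exists (r * (s * u)); split=> //.
  - by rewrite -rtu; apply: refl_mul_len_lt => //; rewrite rtu; exact: gen_refl_len_lt.
  - by exists t.
  - exact: adjacent_gen.
have ut := reduced_refl zu Tt zt; exists (s * (r * u)).
have qE : s * (r * u) = r * (t * u) by rewrite /t -!mulgA (genK _ Sr).
split.
- by apply: refl_mul_len_lt => //; rewrite qE; exact: gen_refl_len_lt.
- by exists s.
- by apply: adjacent_mull; exact: adjacent_gen.
move=> w rw; rewrite -rtu => tw; rewrite qE; apply: le_gen_l => //.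
apply: bruhat_trans tw; apply: edge_le; split.
  by apply: adjacent_mull; exact: adjacent_gen.
apply: refl_mul_len_lt => //; first exact: refl_gen.
by apply: (@refl_gen_len_lt _ z r t) => //; rewrite -st.
Qed.

End Additive.

(** * Atoms of an interval *)

Section Atoms.
Variable W : coxeterSystem.
Local Open Scope group_scope.
Local Notation S := (@cox_gens W).
Local Notation T := (@reflections W).
Local Notation len := (@cox_length W).
Local Notation le := (@bruhat_le W).
Implicit Types (x y z s t r p q u v w a b : W).

Definition covered x y := adjacent x y /\ len y = (len x).+1.

Lemma covered_le x y : covered x y -> le x y.
Proof. by move=> [adj lxy]; apply: edge_le; split=> //; rewrite lxy. Qed.

Lemma covered_gen s x : S s -> (len x < len (s * x))%N -> covered x (s * x).
Proof. by move=> Ss sx; split; [exact: adjacent_gen|exact: len_up]. Qed.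

Lemma le_covered x y : le x y -> len y = (len x).+1 -> covered x y.
Proof. by move=> xy lxy; split=> //; case: (le_edge xy lxy). Qed.

Lemma covered_gen_mul s x y : S s -> covered x y -> y <> s * x ->
  (len (s * x) < len (s * y))%N.
Proof.
move=> Ss [[t Tt ->] lxy] ts; apply: gen_refl_len_lt => //; last by rewrite lxy.
by move=> E; apply: ts; rewrite E.
Qed.

(** The factor z serves the induction on q, which moves letters from q to z; for z = 1 these are the
    atoms of [p, q]. *)
Definition atom z p q b := [/\ covered p b, reduced z b & le b q].

Definition linked z p q b b' := atom z p q b /\ atom z p q b' /\
  exists m, [/\ covered b m, covered b' m, reduced z m & le m q].

Lemma linked_sym z p q b b' : linked z p q b b' -> linked z p q b' b.
Proof. by move=> [ab [ab' [m [bm b'm zm mq]]]]; split=> //; split=> //; exists m. Qed.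

Lemma linkeds_sym z p q b b' : clos_refl_trans _ (linked z p q) b b' ->
  clos_refl_trans _ (linked z p q) b' b.
Proof.
elim=> [x y /linked_sym|x|x y w _ xy _ yw]; [exact: rt_step|exact: rt_refl|].
exact: rt_trans yw xy.
Qed.

Lemma atom_gen z p q s b : S s -> reduced z p -> reduced z q ->
  (len (s * q) < len q)%N -> (len (s * p) < len p)%N ->
  atom (z * s) (s * p) (s * q) b -> (len b < len (s * b))%N /\ atom z p q (s * b).
Proof.
move=> Ss zp zq sq sp [pb zb bq].
have [zs _] := reduced_shift zq Ss sq.
have [sb zsb] := reduced_gen_unshift zb Ss zs; split=> //.
have bp : b <> s * (s * p) by move=> E; move: sb; rewrite E !(genK _ Ss); lia.
have lt := covered_gen_mul Ss pb bp; rewrite (genK _ Ss) in lt.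
split=> //; last by apply: le_gen_l => //; apply: bruhat_trans bq (le_gen_down Ss sq).
split; last by case: pb => _; have := len_down Ss sp; have := len_up Ss sb; lia.
by case: pb => /(adjacent_mull s); rewrite (genK _ Ss).
Qed.

(* Induction along a left descent s of q.  When s p > p every atom is linked to
   s p; otherwise the atoms b with s b < b come from those below s q. *)
Lemma atoms_linked z p q b b' : reduced z p -> reduced z q ->
  atom z p q b -> atom z p q b' -> clos_refl_trans _ (linked z p q) b b'.
Proof.
have [n] := ubnP (len q); elim: n => // n IH in z p q b b' *.
move=> qn zp zq ab ab'; have q1 : q <> 1.
  by move=> E; case: ab => [[_ lb] _ /le_len]; rewrite lb E len1.
have [s Ss sq] := left_descent q1; have [zs zsq] := reduced_shift zq Ss sq.
suff [a aa] : exists a, forall b, atom z p q b -> clos_refl_trans _ (linked z p q) b a.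
  exact: rt_trans (aa _ ab) (linkeds_sym (aa _ ab')).
case: (gen_ltP p Ss) => sp.
  exists (s * p) => {b b' ab ab'} b ab; have [pb zb bq] := ab.
  have [<-|/eqP bsp] := eqVneq b (s * p); first exact: rt_refl.
  have lt := covered_gen_mul Ss pb bsp; have lsp := len_up Ss sp.
  have sb : (len b < len (s * b))%N by case: pb => _ ->; rewrite -lsp.
  have asp : atom z p q (s * p).
    split; [exact: covered_gen|exact: reduced_gen_up|].
    by apply: le_gen_l => //; exact: bruhat_trans (covered_le pb) bq.
  apply: rt_step; split=> //; split=> //; exists (s * b); split.
  - exact: covered_gen.
  - split; first by apply: adjacent_mull; case: pb.
    by rewrite (len_up Ss sb); case: pb => _ ->; rewrite lsp.
  - exact: reduced_gen_up.
  - exact: le_gen_l.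
have [_ zsp] := reduced_shift zp Ss sp.
(* If s a > a, choose an atom c of [s p, s q] covered by a; then a and s c are both covered by s
   a. *)
have down a : atom z p q a -> exists2 c, atom (z * s) (s * p) (s * q) c &
    clos_refl_trans _ (linked z p q) a (s * c).
  move=> aa; have [pa za aq] := aa; case: (gen_ltP a Ss) => sa; last first.
    exists (s * a); last by rewrite genK //; exact: rt_refl.
    have [_ zsa] := reduced_shift za Ss sa; split=> //; last exact: le_gen_lr_down.
    split; first by apply: adjacent_mull; case: pa.
    by case: pa; have := len_down Ss sp; have := len_down Ss sa; lia.
  have zm := reduced_gen_up za Ss zs sa.
  have := reduced_shift zm Ss; rewrite (genK _ Ss) => /(_ sa) [_ zsa].
  have spa : le (s * p) a by exact: bruhat_trans (le_gen_down Ss sp) (covered_le pa).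
  have spNa : s * p <> a.
    by case: pa => _; have := len_down Ss sp; move=> l1 l2 E; move: l1 l2; rewrite E; lia.
  have [t [Tt zst tsp tspa]] := reduced_cover zsa spa spNa.
  set c := t * (s * p) in tsp tspa; have spc : covered (s * p) c by split=> //; exists t.
  have asq : le a (s * q) := le_gen_r Ss sa aq.
  have ac : atom (z * s) (s * p) (s * q) c.
    by split=> //; [exact: reduced_up zsp Tt zst tsp|exact: bruhat_trans tspa asq].
  have ca : covered c a.
    by apply: le_covered => //; case: pa; have := len_down Ss sp; rewrite tsp; lia.
  have [sc asc] := atom_gen Ss zp zq sq sp ac.
  exists c => //; apply: rt_step; split=> //; split=> //.
  exists (s * a); split=> //; first exact: covered_gen.
    split; first by apply: adjacent_mull; case: ca.
    by rewrite (len_up Ss sa) (len_up Ss sc); case: ca => _ ->.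
  exact: le_gen_l.
have [c ac _] := down _ ab; exists (s * c) => a /down [d ad ad']; apply: rt_trans ad' _.
have sqn : (len (s * q) < n)%N by lia.
elim: (IH _ _ _ _ _ sqn zsp zsq ad ac) => {a d ad c ac} [c d|c|c d e _ cd _ de].
- move=> [ac [ad [m [cm dm zm mq]]]]; apply: rt_step.
  have [sc asc] := atom_gen Ss zp zq sq sp ac.
  have [sd asd] := atom_gen Ss zp zq sq sp ad.
  have [sm zsm] := reduced_gen_unshift zm Ss zs.
  split=> //; split=> //; exists (s * m); split=> //.
  + split; first by apply: adjacent_mull; case: cm.
    by rewrite (len_up Ss sm) (len_up Ss sc); case: cm => _ ->.
  + split; first by apply: adjacent_mull; case: dm.
    by rewrite (len_up Ss sm) (len_up Ss sd); case: dm => _ ->.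
  + by apply: le_gen_l => //; exact: bruhat_trans mq (le_gen_down Ss sq).
- exact: rt_refl.
- exact: rt_trans cd de.
Qed.
End Atoms.

(** * Diamond-closed sets *)

Section IntervalEdges.
Variable W : coxeterSystem.
Local Open Scope classical_set_scope.
Local Open Scope group_scope.
Local Notation le := (@bruhat_le W).
Implicit Types (x y u v : W).

Lemma interval_edges_adjacent u v x y : adjacent x y ->
  le u x -> le x v -> le u y -> le y v -> interval_edges u v [set x; y].
Proof.
move=> xy ux xv uy yv; have [t Tt yE] := xy.
case: (refl_ltP x Tt); rewrite -yE => lt.
  by exists x, y; split=> //; split=> //; exists t.
exists y, x; split=> //; last by rewrite setUC.
by split=> //; exists t => //; rewrite yE reflK.
Qed.

Lemma interval_edges_sub u u' v v' : le u u' -> le v' v ->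
  interval_edges u' v' `<=` interval_edges u v.
Proof.
move=> uu' vv' e [x [y [[ux xv] [uy yv] xy ->]]]; exists x, y; split=> //.
  by split; [exact: bruhat_trans uu' ux|exact: bruhat_trans xv vv'].
by split; [exact: bruhat_trans uu' uy|exact: bruhat_trans yv vv'].
Qed.

Lemma pair_set_eq (x y a b : W) : [set x; y] = [set a; b] ->
  (x = a /\ y = b) \/ (x = b /\ y = a).
Proof.
move=> E; have ha : [set x; y] a by rewrite E; left.
have hb : [set x; y] b by rewrite E; right.
have hx : [set a; b] x by rewrite -E; left.
have hy : [set a; b] y by rewrite -E; right.
by case: hx => hx; case: hy => hy; case: ha => ha; case: hb => hb; subst; auto.
Qed.

Lemma interval_edgesP u v x y : interval_edges u v [set x; y] ->
  [/\ adjacent x y, bruhat_interval u v x & bruhat_interval u v y].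
Proof.
move=> [a [b [ua ub [ab _] /pair_set_eq [[-> ->]|[-> ->]]]]]; split=> //.
exact: adjacent_sym.
Qed.
End IntervalEdges.

(** * Propagation inside a diamond-closed set *)

Section Closure.
Variable W : coxeterSystem.
Local Open Scope classical_set_scope.
Local Open Scope group_scope.
Local Notation S := (@cox_gens W).
Local Notation T := (@reflections W).
Local Notation len := (@cox_length W).
Local Notation le := (@bruhat_le W).
Implicit Types (x y z s t r p q u v w a b : W).

Variables (U0 V : W) (C : set (set W)).
Hypothesis C_closed : diamond_closed U0 V C.

Definition saturated x := interval_edges x V `<=` C.

Lemma saturated_le x y : le x y -> saturated x -> saturated y.
Proof.
move=> xy satx; apply: subset_trans satx; apply: interval_edges_sub => //.
exact: bruhat_refl.
Qed.

Lemma saturated_edge x a b : saturated x -> adjacent a b ->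
  le x a -> le a V -> le x b -> le b V -> C [set a; b].
Proof. by move=> satx ab xa aV xb bV; apply: satx; exact: interval_edges_adjacent. Qed.

Lemma closed_square u a b c : le U0 u -> u <> b -> a <> c ->
  adjacent u a -> adjacent a b -> adjacent b c -> adjacent c u ->
  le u a -> le u b -> le u c -> le u V -> le a V -> le b V -> le c V ->
  C [set u; a] -> C [set a; b] -> C [set b; c] /\ C [set c; u].
Proof.
move=> U0u ub ac ua ab bc cu lua lub luc uV aV bV cV.
have U0x x : le u x -> le U0 x by exact: bruhat_trans.
case: C_closed => _; apply; split=> //.
by split; apply: interval_edges_adjacent => //; apply: U0x.
Qed.

(** Two properties pass together along linked atoms a, b below m: the edge to u lies in C, by the
    diamond u, a, m, b, and the atom is saturated, by induction applied to b and its cover m. Edges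
    from u that are not covers are completed to four-cycles by [reduced_square]. *)
Lemma saturated_cover u a : le U0 u -> covered u a -> le a V -> saturated a ->
  C [set u; a] -> saturated u.
Proof.
have [n] := ubnP (len V - len u)%N; elim: n => // n IH in u a *.
move=> un U0u ua aV sata Cua; have lua := covered_le ua.
have uV : le u V by exact: bruhat_trans aV.
have atomE b : atom 1 u V b <-> covered u b /\ le b V.
  by split=> [[]|[ub bV]] //; split=> //; exact: reduced1.
have atoms b : atom 1 u V b -> C [set u; b] /\ saturated b.
  move=> ab; have aa : atom 1 u V a by apply/atomE.
  have H := atoms_linked (reduced1 u) (reduced1 V) aa ab.
  have : C [set u; a] /\ saturated a by [].
  elim: H => {a b ab ua aV sata Cua lua aa} [a b|//|a b c _ IHab _ IHbc].
    move=> [/atomE [ua aV] [/atomE [ub bV] [m [am bm _ mV]]]] [Cua sata].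
    have lam := covered_le am; have lbm := covered_le bm.
    have lua := covered_le ua; have lub := covered_le ub.
    have [->//|/eqP ab] := eqVneq b a.
    have lum : le u m by exact: bruhat_trans lam.
    have Cam : C [set a; m].
      apply: (saturated_edge sata) => //; first by case: am.
      exact: bruhat_refl.
    have [||||||Cmb Cbu] := @closed_square u a m b U0u _ _ _ _ _ _ lua lum lub uV aV mV bV Cua Cam.
    - by move=> E; case: am => _; case: ua => _; rewrite E; lia.
    - by move=> E; exact: ab.
    - by case: ua.
    - by case: am.
    - by apply: adjacent_sym; case: bm.
    - by apply: adjacent_sym; case: ub.
    split; first by rewrite setUC.
    apply: (IH b m) => //.
    + have lV := le_len bV; case: ub => _; lia.
    + exact: bruhat_trans U0u lub.
    + exact: saturated_le lam sata.
    + by rewrite setUC.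
  by move/IHab/IHbc.
have above x : le u x -> le x V -> u <> x -> exists2 b, atom 1 u V b & le b x.
  move=> ux xV nux; have [t [Tt _ tu tux]] := reduced_cover (reduced1 x) ux nux.
  exists (t * u) => //; apply/atomE; split; last exact: bruhat_trans tux xV.
  by split=> //; exists t.
move=> e [x [y [[ux xV] [uy yV] [adj xy] ->]]].
have nuy : u <> y by move=> E; have := le_len ux; rewrite E; lia.
(* An edge whose lower end is not u lies above some atom. *)
have [E|nux] := pselect (u = x); last first.
  have [b /atoms [_ satb] bx] := above x ux xV nux.
  apply: satb; apply: interval_edges_adjacent => //.
  by apply: bruhat_trans bx _; apply: edge_le.
rewrite -{x}E in adj xy ux xV *.
(* The cover z r v of u lies below y and is the second corner of the four-cycle that captures the
   edge from u to y. *)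
have [z [v [w [r [[uE yE] [zv zw] Sr [rv rw] vw]]]]] := reduced_base uy nuy.
have [zr _] := reduced_shift zw Sr rw.
have zrv := reduced_gen_up zv Sr zr rv.
have rvw : le (r * v) w by exact: le_gen_l.
have brv : covered u (z * (r * v)).
  split; first by rewrite uE; apply: adjacent_mull; exact: adjacent_gen.
  by rewrite zrv uE zv (len_up Sr rv) addnS.
have bV : le (z * (r * v)) V.
  by apply: bruhat_trans yV; rewrite yE; exact: reduced_le.
have ab : atom 1 u V (z * (r * v)) by apply/atomE.
have [Cub satb] := atoms _ ab.
have [t Tt tE] := adj.
pose s := z^-1 * t * z; have Ts : T s by exact: refl_conjV.
have wE : w = s * v.
  by apply: (mulgI z); rewrite -yE tE uE /s !mulgA mulgV mul1g.
have [sr|/eqP sr] := eqVneq s r.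
  by rewrite yE wE sr.
have [|q [lq arq asq qw]] := reduced_square zv Sr rv zr Ts sr.
  by rewrite -wE -uE -yE.
rewrite -wE in asq qw.
have qV : le (z * q) V.
  apply: bruhat_trans yV; rewrite yE; apply: reduced_le => //; apply: qw => //.
  exact: le_gen_down.
have bq : le (z * (r * v)) (z * q).
  by apply: edge_le; split=> //; exact: adjacent_mull.
have luq : le u (z * q) by apply: bruhat_trans bq; exact: covered_le.
have [||||||||] := @closed_square u (z * (r * v)) (z * q) y U0u _ _ _ _ _ _ _ luq uy uV bV qV yV Cub.
- by move=> E; move: lq; rewrite -E uE zrv zv; lia.
- rewrite yE wE => /mulgI E; apply: sr; apply: (mulIg v).
  exact: esym.
- by case: brv.
- exact: adjacent_mull.
- by rewrite yE; apply: adjacent_sym; exact: adjacent_mull.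
- exact: adjacent_sym.
- exact: covered_le.
- apply: (saturated_edge satb) => //; [exact: adjacent_mull|exact: bruhat_refl].
by move=> _; rewrite setUC.
Qed.
End Closure.

(** * Chains along right inversions of a left factor *)

Section Chains.
Variable W : coxeterSystem.
Local Open Scope group_scope.
Local Notation S := (@cox_gens W).
Local Notation T := (@reflections W).
Local Notation len := (@cox_length W).
Local Notation le := (@bruhat_le W).
Implicit Types (x y z s t r p q u v w a b : W).

(** If z r > z, no reflection used here equals r, so every step survives multiplication by r; a
    plain Bruhat relation would not. *)
Definition chain_step z a b := exists t,
  [/\ T t, b = t * a, (len a < len b)%N & (len (z * t) < len z)%N].

Definition chain z := clos_refl_trans W (chain_step z).

Lemma chain_le z a b : chain z a b -> le a b.
Proof.
elim=> [x y [t [Tt yE xy _]]|x|x y w _ xy _ yw].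
- by apply: edge_le; split=> //; exists t.
- exact: bruhat_refl.
- exact: bruhat_trans xy yw.
Qed.

Lemma chain_gen z s a b : S s -> (len z < len (z * s))%N -> chain z a b ->
  chain (z * s) (s * a) (s * b).
Proof.
move=> Ss zs; elim=> [x y [t [Tt yE xy zt]]|x|x y w _ xy _ yw].
- have ts : t <> s by move=> E; move: zt; rewrite E; lia.
  apply: rt_step; exists (s * t * s); split; first exact: refl_conj_gen.
  + by rewrite yE !mulgA (mulgenK _ Ss).
  + by rewrite yE; apply: gen_refl_len_lt => //; rewrite -yE.
  have := @refl_mul_len_lt _ t (z * t) s Tt; rewrite -!mulgA (genK _ Ss).
  rewrite (refl_sq Tt) mulg1 => /(_ zt (len_refl_gen_gt Ss Tt ts)).
  by rewrite (reflK _ Tt).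
- exact: rt_refl.
- exact: rt_trans xy yw.
Qed.
End Chains.

(** * Cover edges that need no new generator *)

Section ClosureInduction.
Variable W : coxeterSystem.
Local Open Scope classical_set_scope.
Local Open Scope group_scope.
Local Notation S := (@cox_gens W).
Local Notation T := (@reflections W).
Local Notation len := (@cox_length W).
Local Notation le := (@bruhat_le W).
Implicit Types (x y z s t r p q u v w a b : W).

Variables (U0 V : W) (C : set (set W)).
Hypothesis C_closed : diamond_closed U0 V C.
Local Notation saturated := (saturated V C).

(** The case r u <= r w of a decomposition of V, with the cover z r u of z u already saturated. The
    decomposition varies while V stays fixed. *)
Definition ascends z u w r := [/\ z * w = V, reduced z u /\ reduced z w, S r,
  (len u < len (r * u))%N /\ (len (r * w) < len w)%N & le u w] /\
  le (r * u) (r * w) /\ le U0 (z * u) /\ saturated (z * (r * u)).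

(** Reaches z x without additivity of z and x. At the next letter s of the word: if s y < y, the
    letter passes to zeta and zeta y is unchanged; if s y > y, there is an [ascends] decomposition
    at zeta y with generator s, whose cover zeta s y is saturated by induction on the word. When the
    word is exhausted, r takes the place of s. The chain supplies the order relations required by
    these decompositions. *)
Let saturated_frames z u w r x :
  ascends z u w r ->
  (forall z' u' w' r', (len (z * u) < len (z' * u'))%N -> ascends z' u' w' r' ->
     saturated (z' * u')) ->
  le x w -> le (r * x) (r * w) ->
  forall (c : seq W) (zeta y : W), (forall s, s \in c -> S s) ->
    z = zeta * \prod_(s <- c) s -> len z = (len zeta + size c)%N ->
    reduced zeta y -> le (z * u) (zeta * y) -> (len (z * u) < len (zeta * y))%N ->
    chain zeta y (\prod_(s <- c) s * x) -> saturated (zeta * y).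
Proof.
move=> [[zwV [zu zw] Sr [ru rw] uw] [rurw [U0u satA]]] IH xw rxrw.
have [zr zrw] := reduced_shift zw Sr rw.
elim=> [|s c IHc] zeta y Sc.
  rewrite big_nil mulg1 mul1g => <- _ zy zuy lt yx.
  have uy := reduced_le_cancel zu zuy.
  case: (gen_ltP y Sr) => ry.
    have ryx : le (r * y) (r * x).
      elim: yx {zy zuy lt uy ry} => [a b [t [Tt bE ab zt]]|a|a b d _ ab _ bd].
      - apply: edge_le; split; first by apply: adjacent_mull; exists t.
        by rewrite bE; apply: gen_refl_len_lt => //; rewrite -?bE // => E; move: zt; rewrite E; lia.
      - exact: bruhat_refl.
      - exact: bruhat_trans ab bd.
    apply: (IH z y w r lt); split; [split=> //|split; [|split]].
    - exact: bruhat_trans (chain_le yx) xw.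
    - exact: bruhat_trans ryx rxrw.
    - exact: bruhat_trans U0u zuy.
    - apply: saturated_le satA; apply: reduced_le; first exact: reduced_gen_up.
      exact: le_gen_lr_up.
  apply: saturated_le satA; apply: reduced_le => //.
  exact: le_gen_l.
have Ss : S s by apply: Sc; rewrite inE eqxx.
have Sc' q : q \in c -> S q by move=> qc; apply: Sc; rewrite inE qc orbT.
rewrite big_cons; have [d dE] : exists d, \prod_(q <- c) q = d by eexists.
rewrite dE in IHc * => zE lz zy zuy lt yx.
have ld : (len d <= size c)%N by rewrite -dE; exact: len_prod.
rewrite /= in lz.
have lzs : len (zeta * s) = (len zeta).+1.
  have l1 : (len z <= len (zeta * s) + len d)%N by rewrite zE mulgA lenM.
  have l2 : (len (zeta * s) <= len zeta + 1)%N by rewrite -(len_gen Ss) lenM.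
  by lia.
have adw (ldw : len (d * w) = (size c + len w)%N) : reduced d w.
  have l1 : (len (d * w) <= len d + len w)%N := lenM d w.
  suff : len (d * w) = (len d + len w)%N by []; lia.
have zs : (len zeta < len (zeta * s))%N by rewrite lzs.
have zE' : z = zeta * s * d by rewrite -mulgA.
have lz' : len z = (len (zeta * s) + size c)%N by rewrite lzs lz /= addnS.
have step y' : reduced (zeta * s) y' -> le (z * u) (zeta * s * y') ->
    (len (z * u) < len (zeta * s * y'))%N -> chain (zeta * s) y' (d * x) ->
    saturated (zeta * s * y').
  by move=> a1 a2 a3 a4; exact: (IHc _ _ Sc' zE' lz' a1 a2 a3).
have sdx : s * (s * d * x) = d * x by rewrite -!mulgA genK.
have yx' := chain_gen Ss zs yx; rewrite sdx in yx'.
case: (gen_ltP y Ss) => sy; last first.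
  have E : zeta * s * (s * y) = zeta * y by rewrite -mulgA genK.
  rewrite -E; apply: step => //; rewrite ?E //.
  by have [] := reduced_shift zy Ss sy.
have zsy := reduced_gen_up zy Ss zs sy.
have lzy : (len (zeta * y) < len (zeta * (s * y)))%N.
  by rewrite zy zsy (len_up Ss sy) addnS.
have zyzsy : le (zeta * y) (zeta * (s * y)).
  by apply: reduced_le => //; exact: le_gen.
have szy : reduced (zeta * s) y.
  by rewrite /reduced -mulgA zsy lzs (len_up Ss sy) addnS.
(* Going up from y to s y is a legitimate step because s shortens zeta s. *)
have ysy : chain (zeta * s) y (s * y).
  by apply: rt_step; exists s; split=> //; [exact: refl_gen|rewrite (mulgenK _ Ss)].
have [ldw lsdw] : len (d * w) = (size c + len w)%N /\
    len (s * (d * w)) = (size c + len w).+1%N.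
  have l1 : (len (d * w) <= len d + len w)%N := lenM d w.
  have l2 : (len (z * w) <= len zeta + len (s * (d * w)))%N.
    by rewrite zE -!mulgA lenM.
  have l3 : (len (s * (d * w)) <= (len (d * w)).+1)%N := len_genM _ Ss.
  by move: l2; rewrite zw lz => l2; split; lia.
apply: (IH zeta y (s * (d * w)) s lt); split; [split=> //|split; [|split]].
- by rewrite -zwV zE !mulgA.
- split=> //; rewrite /reduced.
  have -> : zeta * (s * (d * w)) = z * w by rewrite zE !mulgA.
  by rewrite zw lz lsdw /=; lia.
- by rewrite (genK _ Ss) ldw lsdw.
- apply: bruhat_trans (chain_le yx) _; rewrite -mulgA.
  apply: le_gen_lr_up; first by [].
    by rewrite ldw lsdw.
  exact: reduced_le (adw ldw) xw.
- rewrite (genK _ Ss); apply: bruhat_trans (chain_le yx') _; exact: reduced_le (adw ldw) xw.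
- exact: bruhat_trans U0u zuy.
rewrite mulgA; apply: step => //.
- by rewrite -mulgA; exact: bruhat_trans zuy zyzsy.
- by rewrite -mulgA; exact: ltn_trans lt lzy.
- exact: rt_trans ysy yx'.
Qed.

(** In the four-cycle z u, z r u, z q, z x, the edges at z q lie above the saturated elements z r u
    or z x. Closing the cycle puts the cover edge at z u into C, and [saturated_cover] concludes. *)
Lemma ascends_saturated z u w r : ascends z u w r -> saturated (z * u).
Proof.
have [n] := ubnP (len V - len (z * u))%N; elim: n => // n IH in z u w r *.
move=> un asc; have [[zwV [zu zw] Sr [ru rw] uw] [rurw [U0u satA]]] := asc.
have [zr zrw] := reduced_shift zw Sr rw.
have rurwN : r * u <> r * w by move/mulgI => E; move: rw; rewrite -E; lia.
(* The relation r u < r w yields t; its conjugate s = r t r gives a second edge going up from z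
   u. *)
have [t [Tt zrt ltu turw]] := reduced_cover zrw rurw rurwN.
have tr : t <> r by move=> E; move: zrt; rewrite E (mulgenK _ Sr); lia.
pose x := r * (t * (r * u)); pose s := r * t * r.
have xE : x = s * u by rewrite /x /s !mulgA.
have Ts : T s by exact: refl_conj_gen.
have sr : s <> r.
  by move=> /(congr1 (mulg r)); rewrite /s -mulgA genK // gen_sq // => /mulg1_eq; rewrite refl_inv.
have rx : r * x = t * (r * u) by rewrite /x genK.
have ux : (len u < len (s * u))%N.
  rewrite -xE /x -{1}(genK u Sr); apply: gen_refl_len_lt => //.
  by rewrite ltu.
have zs : (len z < len (z * s))%N.
  have := refl_mul_len_lt Tt zrt (len_refl_gen_gt Sr Tt tr).
  by rewrite (mulgenK _ Sr) /s !mulgA.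
have zuzx := refl_mul_len_lt Ts zs ux.
have xw : le x w.
  rewrite -(genK x Sr) rx; apply: le_gen_l => //.
  exact: bruhat_trans turw (le_gen_down Sr rw).
have zxV : le (z * x) V by rewrite -zwV; exact: reduced_le.
have zule : le (z * u) (z * x).
  by apply: edge_le; split; [apply: adjacent_mull; exists s|rewrite xE].
have satB : saturated (z * x).
  (* Start with zeta = 1, the whole word of z still to pass, and the trivial chain at z x. *)
  have [c [Sc cz sc]] := reduced_word z.
  have := @saturated_frames z u w r x asc _ xw _ c 1 (z * x) Sc.
  rewrite cz !mul1g len1 add0n sc; apply=> //.
  - move=> z' u' w' r' lt asc'; apply: IH (asc').
    have : le (z' * u') V.
      have [[<- [_ zw'] _ _ uw'] _] := asc'; exact: reduced_le.
    by move/le_len; lia.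
  - by rewrite rx.
  - exact: reduced1.
  - by rewrite xE.
  - exact: rt_refl.
have [q [lq arq asq qw]] := reduced_square zu Sr ru zr Ts sr zuzx.
rewrite -xE rx in asq qw.
have qV : le (z * q) V.
  rewrite -zwV; apply: reduced_le => //; apply: qw => //.
  exact: bruhat_trans turw (le_gen_down Sr rw).
have zru := reduced_gen_up zu Sr zr ru.
have Aq : le (z * (r * u)) (z * q).
  by apply: edge_le; split=> //; exact: adjacent_mull.
have uA : covered (z * u) (z * (r * u)).
  split; first by apply: adjacent_mull; exact: adjacent_gen.
  by rewrite zru zu (len_up Sr ru) addnS.
have AV : le (z * (r * u)) V by exact: bruhat_trans Aq qV.
have zuV : le (z * u) V by rewrite -zwV; exact: reduced_le.
apply: (saturated_cover C_closed U0u uA AV satA).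
have adjqx : adjacent (z * q) (z * x) by apply: adjacent_sym; exact: adjacent_mull.
have CAq : C [set z * (r * u); z * q].
  apply: (saturated_edge satA) => //; [exact: adjacent_mull|exact: bruhat_refl].
(* The direction of this edge is unknown; whichever end is lower, it lies above a saturated
   element. *)
have Cqx : C [set z * q; z * x].
  have [t' Tt' xqE] := adjqx; case: (refl_ltP (z * q) Tt') => lt.
    apply: (saturated_edge satA) => //; apply: bruhat_trans Aq _.
    by rewrite xqE; apply: edge_le; split=> //; exists t'.
  apply: (saturated_edge satB) => //; last exact: bruhat_refl.
  by apply: edge_le; split; [exact: adjacent_sym|rewrite xqE].
case: C_closed => _ sq.
have ie a b := @interval_edges_adjacent W U0 V a b.
have U0A : le U0 (z * (r * u)) by exact: bruhat_trans U0u (covered_le uA).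
have U0q : le U0 (z * q) by exact: bruhat_trans Aq.
have U0x : le U0 (z * x) by exact: bruhat_trans U0u zule.
have [|_ //] := sq (z * (r * u)) (z * q) (z * x) (z * u) _ CAq Cqx.
split; last split; try (apply: ie => //).
- move/mulgI; rewrite xE => /mulIg E; exact: sr.
- move=> E; have := le_len Aq; rewrite E; case: uA => _; lia.
- exact: adjacent_mull.
- by apply: adjacent_sym; apply: adjacent_mull; exists s.
- by case: uA.
Qed.
End ClosureInduction.

(** * Recursion for the d-invariant *)

Section Recursion.
Variable W : coxeterSystem.
Import Order.TTheory GRing.Theory Num.Theory.
Local Open Scope classical_set_scope.
Local Open Scope group_scope.
Local Notation S := (@cox_gens W).
Local Notation len := (@cox_length W).
Local Notation le := (@bruhat_le W).
Implicit Types (x y z s t r p q u v w a b : W).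

Record d_recursion (d : W -> W -> nat) : Prop := DRecursion {
  d_refl : forall u, d u u = 0%N;
  d_down : forall s u v, S s -> (len (s * u) < len u)%N ->
    (len (s * v) < len v)%N -> le u v -> d u v = d (s * u) (s * v);
  d_up : forall s u v, S s -> (len u < len (s * u))%N ->
    (len (s * v) < len v)%N -> le u v ->
    d u v = (d u (s * v)%g + ~~ `[< le (s * u)%g (s * v)%g >])%N }.

Lemma bruhat_lt_gen s x : S s -> (len x < len (s * x))%N -> bruhat_lt x (s * x).
Proof. by move=> Ss lt; split; [exact: le_gen|move=> E; move: lt; rewrite -E; lia]. Qed.

Lemma bruhat_lt_gen_down s x : S s -> (len (s * x) < len x)%N -> bruhat_lt (s * x) x.
Proof. by move=> Ss lt; split; [exact: le_gen_down|move=> E; move: lt; rewrite E; lia]. Qed.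

Lemma bruhat_ind (P : W -> W -> Prop) : (forall u, P u u) ->
  (forall s u v, S s -> (len (s * u) < len u)%N -> (len (s * v) < len v)%N ->
    le u v -> u <> v -> P (s * u) (s * v) -> P u v) ->
  (forall s u v, S s -> (len u < len (s * u))%N -> (len (s * v) < len v)%N ->
    le u v -> u <> v -> P u (s * v) -> (le (s * u) (s * v) -> P (s * u) (s * v)) -> P u v) ->
  forall u v, le u v -> P u v.
Proof.
move=> Pr Pd Pu u v; have [n] := ubnP (len v); elim: n => // n IH in u v *.
move=> vn uv; have [<-//|/eqP nuv] := eqVneq u v.
have v1 : v <> 1 by move=> E; have := le_lt_len uv nuv; rewrite E len1.
have [s Ss sv] := left_descent v1.
have svn : (len (s * v) < n)%N by lia.
case: (gen_ltP u Ss) => su.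
  apply: (Pu s) => //; last exact: IH.
  by apply: IH => //; exact: le_gen_r.
by apply: (Pd s) => //; apply: IH => //; exact: le_gen_lr_down.
Qed.

Section KazhdanLusztig.
Local Open Scope ring_scope.
Variable R : W -> W -> {poly int}.
Hypothesis hR : KL_R_family R.

Lemma R_down s u v : S s -> (len (s * u)%g < len u)%N -> (len (s * v)%g < len v)%N ->
  le u v -> u <> v -> R u v = R (s * u)%g (s * v)%g.
Proof.
move=> Ss su sv uv nuv; have [_ _ Rd _] := hR.
by apply: Rd => //; exact: bruhat_lt_gen_down.
Qed.

Lemma R_up s u v : S s -> (len u < len (s * u)%g)%N -> (len (s * v)%g < len v)%N ->
  le u v -> u <> v -> R u v = ('X - 1) * R u (s * v)%g + 'X * R (s * u)%g (s * v)%g.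
Proof.
move=> Ss su sv uv nuv; have [_ _ _ Ru] := hR.
by apply: Ru => //; [exact: bruhat_lt_gen_down|exact: bruhat_lt_gen].
Qed.

Lemma R_top u v : le u v -> size (R u v) = (len v - len u).+1 /\ R u v \is monic.
Proof.
elim/bruhat_ind => [{}u|s {}u {}v Ss su sv uv nuv IH|s {}u {}v Ss su sv uv nuv IH1 IH2].
- by have [_ -> _ _] := hR; rewrite size_poly1 subnn monic1.
- rewrite (R_down Ss su sv uv nuv); have := len_down Ss su; have := len_down Ss sv.
  by move=> -> ->; rewrite subSS.
have luv := le_lt_len uv nuv; have lsv := len_down Ss sv.
have [sR mR] := IH1; have X1 : ('X - 1 : {poly int}) = 'X - 1%:P by rewrite polyC1.
have m1 : ('X - 1) * R u (s * v)%g \is monic by rewrite X1 rpredM ?monicXsubC.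
have s1 : size (('X - 1) * R u (s * v)%g) = (len v - len u).+1.
  rewrite X1 size_Mmonic ?polyXsubC_eq0 // size_XsubC sR lsv /=; lia.
have s2 : (size ('X * R (s * u)%g (s * v)%g)%R < (len v - len u).+1)%N.
  have [su_sv|su_sv] := pselect (le (s * u)%g (s * v)%g).
    have [s2 _] := IH2 su_sv; have := le_len su_sv; have := len_up Ss su.
    rewrite mulrC size_mulX -?size_poly_eq0 s2 //; lia.
  by have [R0 _ _ _] := hR; rewrite (R0 _ _ su_sv) mulr0 size_poly0.
rewrite (R_up Ss su sv uv nuv) size_polyDl ?s1 //; split=> //.
by rewrite monicE lead_coefDl ?s1 // -monicE.
Qed.

Lemma R_lead u v : le u v -> (R u v)`_(len v - len u) = 1.
Proof. by move=> /R_top [sR /monicP]; rewrite lead_coefE sR. Qed.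

Lemma d_invariant_refl u : d_invariant R u u = 0.
Proof. by rewrite /d_invariant subnn coefXM oppr0. Qed.

Lemma d_invariant_down s u v : S s -> (len (s * u)%g < len u)%N ->
  (len (s * v)%g < len v)%N -> le u v -> d_invariant R u v = d_invariant R (s * u)%g (s * v)%g.
Proof.
move=> Ss su sv uv; have [->|/eqP nuv] := eqVneq u v; first by rewrite !d_invariant_refl.
rewrite /d_invariant (R_down Ss su sv uv nuv).
by rewrite (len_down Ss su) (len_down Ss sv) subSS.
Qed.

(** The factor q - 1 contributes minus the leading coefficient of R(u, s v), which is 1. If s u <= s
    v, then q R(s u, s v) is monic of degree l(u, v) - 1 and cancels it. *)
Lemma d_invariant_up s u v : S s -> (len u < len (s * u)%g)%N ->
  (len (s * v)%g < len v)%N -> le u v ->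
  d_invariant R u v = d_invariant R u (s * v)%g + (~~ `[< le (s * u)%g (s * v)%g >])%:R.
Proof.
move=> Ss su sv uv; have nuv : u <> v by move=> E; rewrite -E in sv; lia.
have usv := le_gen_r Ss su uv.
have ln : (len v - len u)%N = (len (s * v)%g - len u).+1.
  by rewrite (len_down Ss sv) subSn //; exact: le_len.
rewrite /d_invariant (R_up Ss su sv uv nuv) ln coefXM /=.
rewrite coefD coefXM mulrBl coefB mul1r coefXM (R_lead usv).
have [b|b] := asboolP (le _ _); last first.
  by have [R0 _ _ _] := hR; rewrite (R0 _ _ b) coef0 if_same /=; ring.
have ln' : (len (s * v)%g - len u)%N = (len (s * v)%g - len (s * u)%g).+1.
  by have := le_len b; have := len_up Ss su; lia.
by rewrite ln' /= (R_lead b) /=; ring.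
Qed.

Lemma d_invariant_ge0 u v : le u v -> 0 <= d_invariant R u v.
Proof.
elim/bruhat_ind => [{}u|s {}u {}v Ss su sv uv nuv IH|s {}u {}v Ss su sv uv nuv IH _].
- by rewrite d_invariant_refl.
- by rewrite (d_invariant_down Ss).
- by rewrite (d_invariant_up Ss) // addr_ge0.
Qed.

Lemma d_invariant_recursion : d_recursion (fun u v => `|d_invariant R u v|%N).
Proof.
split=> [u|s u v Ss su sv uv|s u v Ss su sv uv].
- by rewrite d_invariant_refl.
- by rewrite (d_invariant_down Ss).
rewrite (d_invariant_up Ss) //; have := d_invariant_ge0 (le_gen_r Ss su uv).
by case: (d_invariant _ _ _) => // n _; case: asboolP => _ /=; rewrite ?addr0 ?addn0 //; lia.
Qed.
End KazhdanLusztig.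

(** * Generating sets of size d *)

Section UpperBound.
Variable d : W -> W -> nat.
Hypothesis hd : d_recursion d.

Lemma d_reduced z p q : reduced z p -> reduced z q -> le p q ->
  d (z * p) (z * q) = d p q.
Proof.
elim/reduced_ind: z p q => [|z s Ss zs IH] p q zp zq pq; first by rewrite !mul1g.
have [sp zsp] := reduced_gen_unshift zp Ss zs.
have [sq zsq] := reduced_gen_unshift zq Ss zs.
rewrite -!mulgA IH //; last exact: le_gen_lr_up.
by rewrite (d_down hd Ss) ?(genK _ Ss) //; exact: le_gen_lr_up.
Qed.

(** After z is cancelled, both d(u, w) and d(r u, w) are compared with d(u, r w). *)
Lemma d_base z u w r : reduced z u -> reduced z w -> S r ->
  (len u < len (r * u))%N -> (len (r * w) < len w)%N -> le u w ->
  d (z * u) (z * w) =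
    (d (z * (r * u))%g (z * w)%g + ~~ `[< le (r * u)%g (r * w)%g >])%N.
Proof.
move=> zu zw Sr ru rw uw; have [zr _] := reduced_shift zw Sr rw.
have ruw := le_gen_l Sr rw uw.
rewrite !d_reduced // ?(d_up hd Sr ru rw uw); last exact: reduced_gen_up.
by rewrite (d_down hd Sr _ rw ruw) (genK _ Sr).
Qed.

(** The last clause ranges over all closed sets C, so that the induction can intersect C with the
    edges of a smaller interval. *)
Lemma generating_exists u v : le u v ->
  exists F : set (set W), [/\ F `<=` interval_edges u v, (F #= `I_(d u v))%card &
    forall C, diamond_closed u v C -> F `<=` C -> interval_edges u v `<=` C].
Proof.
have [n] := ubnP (len v - len u)%N; elim: n => // n IH in u *; move=> un uv.
have [<-|/eqP nuv] := eqVneq u v.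
  exists set0; rewrite (d_refl hd) II0; split=> // C _ _ e.
  move=> [x [y [[ux xu] [uy yu] [_ xy] _]]].
  by have := le_len ux; have := le_len yu; lia.
have [z [p [w [r [[uE vE] [zp zw] Sr [rp rw] pw]]]]] := reduced_base uv nuv.
have [zr _] := reduced_shift zw Sr rw.
have zrp := reduced_gen_up zp Sr zr rp.
have rpw : le (r * p) w by exact: le_gen_l.
pose a := z * (r * p).
have ua : covered u a.
  split; first by rewrite uE; apply: adjacent_mull; exact: adjacent_gen.
  by rewrite /a zrp uE zp (len_up Sr rp) addnS.
have av : le a v by rewrite vE; exact: reduced_le.
have [|F [FE Fcard Fgen]] := IH a _ av.
  by case: ua => _; have := le_len av; lia.
have closed_a C : diamond_closed u v C -> diamond_closed a v (C `&` interval_edges a v).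
  move=> [CE Cd]; split=> [|w1 w2 w3 w4 [n13 n24 [e1 e2 e3 e4]] [C1 _] [C2 _]].
    by move=> e [].
  have sub : interval_edges a v `<=` interval_edges u v.
    by apply: interval_edges_sub; [exact: covered_le|exact: bruhat_refl].
  have [|C3 C4] := Cd w1 w2 w3 w4 _ C1 C2; first by split=> //; split; apply: sub.
  by split.
have sat C : diamond_closed u v C -> F `<=` C -> saturated v C a.
  move=> Cd FC; have := Fgen _ (closed_a C Cd); move/(_ _)/subset_trans; apply.
    by move=> e Fe; split; [exact: FC|exact: FE].
  by move=> e [].
have FE' : F `<=` interval_edges u v.
  apply: subset_trans FE _; apply: interval_edges_sub; first exact: covered_le.
  exact: bruhat_refl.
have := d_base zp zw Sr rp rw pw; rewrite -uE -vE -/a.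
have [b|b] := asboolP (le _ _) => /= duv.
  exists F; split=> //; first by rewrite duv addn0.
  move=> C Cd FC; have := @ascends_saturated W u v C Cd z p w r.
  rewrite -uE; apply; split=> //; split=> //; rewrite -uE.
  by split; [exact: bruhat_refl|exact: sat].
exists (F `|` [set [set u; a]]); split.
- move=> e [/FE'//|->]; apply: interval_edges_adjacent => //; last exact: covered_le.
  + by case: ua.
  + exact: bruhat_refl.
- rewrite duv addn1; apply/eq_cardSP; exists [set u; a]; first by right.
  rewrite setUDK // => e [-> /FE /interval_edgesP [_ [au _] _]].
  by case: ua => _; have := le_len au; lia.
move=> C Cd FC; apply: (saturated_cover Cd (bruhat_refl u) ua av).
  by apply: sat => // e Fe; apply: FC; left.
by apply: FC; right.
Qed.
End UpperBound.
End Recursion.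

(** * Potentials *)

Section Potentials.
Variables (R : realType) (W : coxeterSystem) (g : georep R W).
Import Order.TTheory GRing.Theory Num.Theory.
Local Open Scope classical_set_scope.
Local Open Scope ring_scope.
Local Notation S := (@cox_gens W).
Local Notation T := (@reflections W).
Local Notation len := (@cox_length W).
Local Notation le := (@bruhat_le W).
Local Notation act := (geoact g).
Local Notation cart := (geocart g).
Implicit Types (phi psi : W -> R) (x y z h s t r u v w : W) (m : (W -> R) -> R).

(** The multiples of the root of t, characterised without choosing a sign for that root. *)
Definition root_form t m :=
  (forall (c : R) phi psi, m (fun w => phi w + c * psi w) = m phi + c * m psi) /\
  forall phi, m (act t phi) = - m phi.

Lemma root_form_comb t (c c' : R) m m' : root_form t m -> root_form t m' ->
  root_form t (fun phi => c * m phi + c' * m' phi).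
Proof.
move=> [ml mt] [ml' mt']; split=> [d phi psi|phi].
  by rewrite ml ml'; ring.
by rewrite mt mt'; ring.
Qed.

Lemma root_form_diff x y s : T (x^-1 * y)%g ->
  root_form (x^-1 * y)%g (fun phi => act y phi s - act x phi s).
Proof.
move=> Tt; split=> [c phi psi|phi]; first by rewrite !act_linear; ring.
rewrite -!geoactM mulKVg.
have -> : (y * (x^-1 * y))%g = x.
  by rewrite -{1}(mulKVg x y) -mulgA refl_sq // mulg1.
by ring.
Qed.

(** The reflection moves phi by a multiple of its coroot [act h (cart s)], so a negated form is
    determined by its value there. *)
Lemma root_form_scale h s m : S s -> root_form (h * s * h^-1)%g m ->
  forall phi, 2 * m phi = m (act h (cart s)) * act h^-1%g phi s.
Proof.
move=> Ss [ml mt] phi; have := mt phi.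
have -> : act (h * s * h^-1)%g phi =
    (fun w => phi w + (- act h^-1%g phi s) * act h (cart s) w).
  by apply/funext => w; rewrite act_conj //; ring.
by rewrite ml; lra.
Qed.

(** The coroot is a test vector: constancy along an edge becomes one linear equation. *)
Lemma root_form_dual t : T t -> exists b, forall m, root_form t m -> m b = 0 ->
  forall phi, m phi = 0.
Proof.
move=> [h [s [Ss ->]]]; exists (act h (cart s)) => m /(root_form_scale Ss) mE m0 phi.
by have := mE phi; rewrite m0; lra.
Qed.

(** A nonzero common form would make the two roots proportional, hence the reflections equal. *)
Lemma root_form_eq0 t t' m : T t -> T t' -> t <> t' ->
  root_form t m -> root_form t' m -> forall phi, m phi = 0.
Proof.
move=> [h [s [Ss tE]]] [h' [s' [Ss' tE']]] tt'.
rewrite tE tE' => /(root_form_scale Ss) mE /(root_form_scale Ss') mE'.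
set c := m (act h (cart s)) in mE; set c' := m (act h' (cart s')) in mE'.
have [c0 phi|/eqP c0] := eqVneq c 0; first by have := mE phi; rewrite c0; lra.
case: tt'; rewrite tE tE'.
have := @proportional_root R W g (h^-1 * h')%g s s' (c' / c) Ss Ss'.
have prop phi : act (h^-1 * h')%g phi s = c' / c * phi s'.
  have := mE' (act h' phi); rewrite -geoactM mulVg geoact1 mE => E.
  by rewrite geoactM mulrAC -E mulrAC divff ?mul1r //; exact/eqP.
move/(_ prop) <-; by rewrite invgM invgK !mulgA mulgV mul1g mulgK.
Qed.

Lemma form_gen_neq0 x s : S s -> exists phi, act x phi s <> 0.
Proof.
move=> Ss; exists (fun=> 1); have d1 : dominant (fun=> 1) := @dominant1 R W.
by case: (gen_ltP x Ss) => [/(act_pos g Ss)|/(act_neg g Ss)] /(_ _ d1) H E;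
  move: H; rewrite E ltxx.
Qed.

Lemma form_genN x s phi : S s -> act (s * x)%g phi s = - act x phi s.
Proof. by move=> Ss; rewrite geoactM (geoactS g _ _ Ss) geocart_diag //; ring. Qed.

Definition potential u v (f : W -> (W -> R) -> R) := forall x y,
  le u x -> le x v -> le u y -> le y v -> adjacent x y ->
  root_form (x^-1 * y)%g (fun phi => f y phi - f x phi).

Lemma adjacent_refl x y : adjacent x y -> T (x^-1 * y)%g.
Proof. by move=> [t Tt ->]; rewrite mulgA; exact: refl_conjV. Qed.

Lemma potential_gen u v s : potential u v (fun x phi => act x phi s).
Proof. by move=> x y _ _ _ _ /adjacent_refl; exact: root_form_diff. Qed.

Lemma potential_comb u v (c c' : R) f f' : potential u v f -> potential u v f' ->
  potential u v (fun x phi => c * f x phi + c' * f' x phi).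
Proof.
move=> pf pf' x y ux xv uy yv xy.
have := root_form_comb c c' (pf x y ux xv uy yv xy) (pf' x y ux xv uy yv xy).
have -> : (fun phi => c * (f y phi - f x phi) + c' * (f' y phi - f' x phi)) =
  (fun phi => c * f y phi + c' * f' y phi - (c * f x phi + c' * f' x phi)) => //.
by apply/funext => phi; ring.
Qed.

Lemma potential_sum u v n (c : 'I_n -> R) (f : 'I_n -> W -> (W -> R) -> R) :
  (forall i, potential u v (f i)) ->
  potential u v (fun x phi => \sum_i c i * f i x phi).
Proof.
move=> pf; elim: n => [|n IH] in c f pf *.
  move=> x y _ _ _ _ _; split=> [d phi psi|phi]; rewrite !big_ord0; ring.
have := potential_comb (c ord0) 1 (pf ord0) (IH (fun i => c (lift ord0 i)) _ (fun i => pf (lift ord0 i))).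
set F := (F in potential u v F); set F' := (F' in _ -> potential u v F').
have -> : F = F' => //.
by apply/funext => x; apply/funext => phi; rewrite /F /F' big_ord_recl mul1r.
Qed.

Lemma potential_sub u v u' v' f : le u u' -> le v' v -> potential u v f ->
  potential u' v' f.
Proof.
move=> uu' vv' pf x y ux xv uy yv; apply: pf; [exact: bruhat_trans ux| |exact: bruhat_trans uy|].
  exact: bruhat_trans vv'.
exact: bruhat_trans vv'.
Qed.

Lemma potential_gen_diff u v f s x : potential u v f -> S s ->
  le u x -> le x v -> le u (s * x)%g -> le (s * x)%g v ->
  exists k, forall phi, f (s * x)%g phi - f x phi = k * act x phi s.
Proof.
move=> pf Ss ux xv usx sxv.
have := pf x (s * x)%g ux xv usx sxv (adjacent_gen x Ss).
rewrite mulgA => m.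
have := @root_form_scale x^-1%g s (fun phi => f (s * x)%g phi - f x phi) Ss.
rewrite invgK => /(_ m) mE; eexists (_ / 2) => phi.
by rewrite mulrAC; apply: (canRL (mulfK _)); rewrite ?pnatr_eq0 // mulrC mE.
Qed.

(* Along the lower half of the interval the difference of f across x, s x is a
   fixed multiple of the form of s, since forms of distinct reflections are
   independent. *)
Lemma potential_gen_const u v f s (k : R) x : potential u v f -> S s ->
  (len u < len (s * u)%g)%N -> (forall phi, f (s * u)%g phi - f u phi = k * act u phi s) ->
  le u x -> (len x < len (s * x)%g)%N -> le (s * x)%g v ->
  forall phi, f (s * x)%g phi - f x phi = k * act x phi s.
Proof.
move=> pf Ss su fu ux sx sxv.
have up y : le u y -> le y x -> [/\ le y v, le u (s * y)%g & le (s * y)%g v].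
  move=> uy yx; split.
  - exact: bruhat_trans yx (bruhat_trans (le_gen Ss sx) sxv).
  - by apply: le_gen_r.
  - by apply: bruhat_trans sxv; exact: le_gen_lr_up.
suff : forall y, le u y -> le y x -> forall phi, f (s * y)%g phi - f y phi = k * act y phi s.
  by apply=> //; exact: bruhat_refl.
move=> y uy; elim: (clos_rt_rtn1 _ _ _ _ uy) => [//|a b ab ua IH] bx.
have {}ua := clos_rtn1_rt _ _ _ _ ua.
have ax : le a x := bruhat_trans (edge_le ab) bx.
have ub : le u b := bruhat_trans ua (edge_le ab).
have [av usa sav] := up a ua ax; have [bv usb sbv] := up b ub bx.
case: (edge_gen Ss ab) => [bE|[adj' _]].
  by move=> phi; rewrite bE genK // form_genN // mulrN -IH //; ring.
have adj : adjacent a b by case: ab.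
have [k' kE] := potential_gen_diff pf Ss ub bv usb sbv.
have [bE|/eqP bE] := eqVneq b (s * a)%g.
  by move=> phi; rewrite bE genK // form_genN // mulrN -IH //; ring.
have rf := pf _ _ usa sav usb sbv adj'.
have E : ((s * a)^-1 * (s * b))%g = (a^-1 * b)%g.
  by rewrite invgM (gen_inv Ss) -mulgA (genK _ Ss).
rewrite E in rf; have rf' := pf _ _ ua av ub bv adj.
have rc := root_form_diff s (adjacent_refl adj).
have r1 : root_form (a^-1 * b)%g (fun phi => (k' - k) * act a phi s).
  have := root_form_comb 1 (- k') (root_form_comb 1 (-1) rf rf') rc.
  set F := (F in root_form _ F); set F' := (F' in _ -> root_form _ F').
  have -> : F = F' => //; apply/funext => phi; rewrite /F /F'.
  have e1 := IH ax phi; have e2 := kE phi.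
  have e3 : f (s * b)%g phi = f b phi + k' * act b phi s by rewrite -e2; ring.
  have e4 : f (s * a)%g phi = f a phi + k * act a phi s by rewrite -e1; ring.
  by rewrite e3 e4; ring.
have r2 : root_form (a^-1 * s * a)%g (fun phi => (k' - k) * act a phi s).
  have Tasa : T (a^-1 * (s * a))%g by exact/adjacent_refl/adjacent_gen.
  have := root_form_comb (- (k' - k) / 2) 0 (root_form_diff s Tasa) (root_form_diff s Tasa).
  rewrite mulgA; set F := (F in root_form _ F); set F' := (F' in _ -> root_form _ F').
  have -> : F = F' => //; apply/funext => phi; rewrite /F /F' form_genN //.
  by field.
have ne : (a^-1 * b)%g <> (a^-1 * s * a)%g.
  by move=> ne; apply: bE; apply: (mulgI a^-1%g); rewrite ne mulgA.
have Ts : T (a^-1 * s * a)%g by apply: refl_conjV; exact: refl_gen.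
have z := root_form_eq0 (adjacent_refl adj) Ts ne r1 r2.
have [psi psi0] := form_gen_neq0 a Ss.
have kk : k' = k.
  by have /eqP := z psi; rewrite mulf_eq0 subr_eq0 => /orP[/eqP//|/eqP].
by rewrite -kk.
Qed.

(** Let k be the jump of f across x, s x, in units of x^-1 s. Adding k/2 times this form, which
    changes sign under s, makes f invariant; an invariant f is extended by its value at s x, and the
    correction is subtracted again. If s u is not below s v, no pair x, s x lies in [u, s v], so k =
    0 and the extension is itself invariant. *)
Lemma potential_extend u v s f : S s -> (len u < len (s * u)%g)%N ->
  (len (s * v)%g < len v)%N -> potential u (s * v)%g f ->
  exists f', [/\ potential u v f',
    forall x, le x (s * v)%g -> f' x = f x &
    ~ le (s * u)%g (s * v)%g -> forall x, le u x -> le x v -> f' (s * x)%g = f' x].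
Proof.
move=> Ss su sv pf.
have usx x : le u x -> le u (s * x)%g by exact: le_gen_r.
have [k [kE k0]] : exists k : R, (forall x, le u x -> le x (s * v)%g ->
    le (s * x)%g (s * v)%g -> forall phi, f (s * x)%g phi - f x phi = k * act x phi s) /\
    (~ le (s * u)%g (s * v)%g -> k = 0).
  have [susv|susv] := pselect (le (s * u)%g (s * v)%g); last first.
    exists 0; split=> // x ux xsv sxsv; case: susv.
    case: (gen_ltP x Ss) => sx.
      apply: bruhat_trans sxsv; exact: le_gen_lr_up.
    apply: bruhat_trans xsv; exact: le_gen_l.
  have uv : le u (s * v)%g := bruhat_trans (le_gen Ss su) susv.
  have [k kE] := potential_gen_diff pf Ss (bruhat_refl u) uv (le_gen Ss su) susv.
  exists k; split=> // x ux xsv sxsv phi; case: (gen_ltP x Ss) => sx.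
    exact: (potential_gen_const pf Ss su kE).
  have ssx : (len (s * x)%g < len (s * (s * x))%g)%N by rewrite genK.
  have := potential_gen_const pf Ss su kE (usx x ux) ssx.
  rewrite genK // => /(_ xsv phi); rewrite form_genN // => H.
  by rewrite -opprB H; ring.
pose c x phi := act x phi s.
pose f1 x phi := 1 * f x phi + (k / 2) * c x phi.
have pf1 : potential u (s * v)%g f1 by refine (potential_comb 1 (k / 2) pf (potential_gen s)).
have f1s x : le u x -> le x (s * v)%g -> le (s * x)%g (s * v)%g -> f1 (s * x)%g = f1 x.
  move=> ux xsv sxsv; apply/funext => phi; rewrite /f1 /c form_genN //.
  have E : f (s * x)%g phi = f x phi + k * act x phi s.
    by rewrite -(kE x ux xsv sxsv phi); ring.
  by rewrite E; field.
pose f2 x := if `[< le x (s * v)%g >] then f1 x else f1 (s * x)%g.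
have down x : le x v -> ~ le x (s * v)%g -> le (s * x)%g (s * v)%g.
  move=> xv xsv; apply: le_gen_lr_down => //; case: (gen_ltP x Ss) => // sx.
  by case: xsv; apply: le_gen_r.
have f2s x : le u x -> le x v -> f2 (s * x)%g = f2 x.
  move=> ux xv; rewrite /f2.
  have [xsv|xsv] := asboolP (le x _); have [sxsv|sxsv] := asboolP (le (s * x)%g _) => //.
  - exact: f1s.
  - by rewrite genK.
  - by case: sxsv; exact: down.
have conj x y : ((s * x)^-1 * (s * y))%g = (x^-1 * y)%g.
  by rewrite invgM (gen_inv Ss) -mulgA (genK _ Ss).
have pf2 : potential u v f2.
  suff lt x y : le u x -> le x v -> le u y -> le y v -> adjacent x y -> (len x < len y)%N ->
      root_form (x^-1 * y)%g (fun phi => f2 y phi - f2 x phi).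
    move=> x y ux xv uy yv xy; have [t Tt yE] := xy.
    case: (refl_ltP x Tt); rewrite -yE => H; first exact: lt.
    have [ml mt] := lt y x uy yv ux xv (adjacent_sym xy) H.
    have E : (y^-1 * x)%g = (x^-1 * y)%g.
      by rewrite -[RHS](refl_inv (adjacent_refl xy)) invgM invgK.
    rewrite E in mt; split=> [d phi psi|phi].
      by have := ml d phi psi => H'; lra.
    by have := mt phi => H'; lra.
  move=> ux xv uy yv xy lxy; have [exy|exy] := pselect (y = (s * x)%g).
    rewrite exy f2s //; split=> [d phi psi|phi]; ring.
  have edge_xy : bruhat_edge x y by [].
  have xy' : adjacent (s * x)%g (s * y)%g by exact: adjacent_mull.
  have sxy : le (s * x)%g (s * y)%g.
    by case: (edge_gen Ss edge_xy) => // /edge_le.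
  rewrite {1 2}/f2; have [ysv|ysv] := asboolP (le y _).
    have xsv : le x (s * v)%g := bruhat_trans (edge_le edge_xy) ysv.
    by rewrite (asboolT xsv); exact: pf1.
  have sysv := down y yv ysv; have sxsv := bruhat_trans sxy sysv.
  have -> : (if `[< le x (s * v)%g >] then f1 x else f1 (s * x)%g) = f1 (s * x)%g.
    by case: asboolP => // xsv; rewrite f1s.
  rewrite -conj; apply: pf1 => //; exact: usx.
exists (fun x phi => 1 * f2 x phi + (- (k / 2)) * c x phi); split.
- exact: (potential_comb 1 (- (k / 2)) pf2 (potential_gen s)).
- move=> x xsv; apply/funext => phi; rewrite /f2 (asboolT xsv) /f1; ring.
- move=> /k0 -> x ux xv; apply/funext => phi; rewrite f2s //; ring.
Qed.

Definition independent u v n (f : 'I_n -> W -> (W -> R) -> R) :=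
  forall c : 'I_n -> R, (forall x, le u x -> le x v -> forall phi,
    \sum_i c i * f i x phi = \sum_i c i * f i u phi) -> forall i, c i = 0.

Lemma potentials_extend u v s n (f : 'I_n -> W -> (W -> R) -> R) : S s ->
  (len u < len (s * u)%g)%N -> (len (s * v)%g < len v)%N ->
  (forall i, potential u (s * v)%g (f i)) ->
  exists f' : 'I_n -> W -> (W -> R) -> R, [/\ forall i, potential u v (f' i),
    forall i x, le x (s * v)%g -> f' i x = f i x &
    ~ le (s * u)%g (s * v)%g -> forall i x, le u x -> le x v -> f' i (s * x)%g = f' i x].
Proof.
move=> Ss su sv pf.
have [f' f'E] := choice (fun i => potential_extend Ss su sv (pf i)).
by exists f'; split=> [i|i|susv i]; have [p1 p2 p3] := f'E i => //; exact: p3.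
Qed.

(** When s u < u, potentials on [s u, s v] are extended to [s u, v] and restricted to [u, v]. A
    combination constant on [u, v] turns out invariant under s, hence constant on all of [s u, v],
    so no independence is lost. *)
Lemma independent_potentials (d : W -> W -> nat) : d_recursion d -> forall u v, le u v ->
  exists f : 'I_(d u v) -> W -> (W -> R) -> R,
    (forall i, potential u v (f i)) /\ independent u v f.
Proof.
move=> hd; apply: bruhat_ind => [u|s u v Ss su sv uv nuv [f [pf indf]]|
    s u v Ss su sv uv nuv [f [pf indf]] _].
- rewrite (d_refl hd); exists (fun _ _ _ => 0); split=> [[]//|c _ []//].
- rewrite (d_down hd Ss) //.
  have ssu : (len (s * u)%g < len (s * (s * u))%g)%N by rewrite genK.
  have [f' [pf' f'E f's]] := potentials_extend Ss ssu sv pf.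
  have suv : le (s * u)%g v := bruhat_trans (le_gen_down Ss su) uv.
  exists f'; split=> [i|c cE i].
    by apply: potential_sub (pf' i); [exact: le_gen_down|exact: bruhat_refl].
  pose F x phi := \sum_i c i * f' i x phi.
  have pF : potential (s * u)%g v F by exact: potential_sum.
  have FE x : le u x -> le x v -> forall phi, F x phi = F u phi by exact: cE.
  have Fs x : le (s * u)%g x -> le x v -> forall phi, F (s * x)%g phi = F x phi.
    (* If u <= s v, then F agrees at v and s v, which forces its jump to be zero; otherwise the
       extensions are already invariant. *)
    move=> sux xv phi; have [usv|usv] := pselect (le u (s * v)%g); last first.
      by rewrite /F; apply: eq_bigr => j _; rewrite f's ?genK.
    have uu : le (s * (s * u))%g v by rewrite genK.
    have [k kE] := potential_gen_diff pF Ss (bruhat_refl _) suv (le_gen Ss ssu) uu.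
    have k0 : k = 0.
      have ssv : (len (s * v)%g < len (s * (s * v))%g)%N by rewrite genK.
      have sv' : le (s * (s * v))%g v by rewrite genK //; exact: bruhat_refl.
      have [psi psi0] := form_gen_neq0 (s * v)%g Ss.
      have susv : le (s * u)%g (s * v)%g by exact: le_gen_lr_down.
      have := potential_gen_const pF Ss ssu kE susv ssv sv' psi.
      rewrite genK // (FE v uv (bruhat_refl v)) (FE _ usv (le_gen_down Ss sv)) subrr.
      by move/esym/eqP; rewrite mulf_eq0 => /orP[/eqP //|/eqP].
    have const y : le (s * u)%g y -> (len y < len (s * y)%g)%N -> le (s * y)%g v -> F (s * y)%g phi = F y phi.
      move=> suy sy syv; apply/eqP; rewrite -subr_eq0.
      by rewrite (potential_gen_const pF Ss ssu kE suy sy syv) k0 mul0r.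
    case: (gen_ltP x Ss) => sx; first by apply: const => //; exact: le_gen_l.
    have := const (s * x)%g (le_gen_r Ss ssu sux); rewrite genK // => /(_ sx xv) E.
    exact: esym.
  have Fc x : le (s * u)%g x -> le x v -> forall phi, F x phi = F u phi.
    move=> sux xv phi; case: (gen_ltP x Ss) => sx.
      rewrite -Fs // FE //; last exact: le_gen_l.
      by rewrite -(genK u Ss); apply: le_gen_lr_up.
    by apply: FE => //; rewrite -(genK u Ss); apply: le_gen_l.
  apply: indf => x sux xsv phi.
  have E y : le y (s * v)%g -> \sum_i c i * f i y phi = F y phi.
    by move=> ysv; apply: eq_bigr => j _; rewrite f'E.
  have xv : le x v := bruhat_trans xsv (le_gen_down Ss sv).
  rewrite !E ?Fc //; [exact: bruhat_refl|exact: le_gen_lr_down].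
have [f' [pf' f'E f's]] := potentials_extend Ss su sv pf.
have usv : le u (s * v)%g by exact: le_gen_r.
have svv := le_gen_down Ss sv.
have restrict (c : 'I_(d u (s * v)%g) -> R) : (forall x, le u x -> le x v -> forall phi,
    \sum_i c i * f' i x phi = \sum_i c i * f' i u phi) -> forall i, c i = 0.
  move=> cE; apply: indf => x ux xsv phi.
  have E y : le y (s * v)%g -> \sum_i c i * f i y phi = \sum_i c i * f' i y phi.
    by move=> ysv; apply: eq_bigr => j _; rewrite f'E.
  by rewrite !E // cE //; exact: bruhat_trans svv.
rewrite (d_up hd Ss) //; have [susv|susv] := asboolP (le (s * u)%g _) => /=.
  by rewrite addn0; exists f'; split=> // c; exact: restrict.
rewrite addn1; exists (fun i => if unlift ord0 i is Some j then f' j else fun x phi => act x phi s).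
split=> [i|c cE].
  by case: unliftP => [j|] _; [exact: pf'|exact: potential_gen].
have {}cE x : le u x -> le x v -> forall phi,
    c ord0 * act x phi s + \sum_i c (lift ord0 i) * f' i x phi =
    c ord0 * act u phi s + \sum_i c (lift ord0 i) * f' i u phi.
  move=> ux xv phi; have := cE x ux xv phi; rewrite !big_ord_recl !unlift_none.
  under eq_bigr do rewrite liftK; under [in X in _ = X -> _]eq_bigr do rewrite liftK.
  by [].
(* Between u and s u the extended potentials do not change, while x^-1 s changes sign. *)
have c0 : c ord0 = 0.
  have [psi psi0] := form_gen_neq0 u Ss.
  have := cE (s * u)%g (le_gen Ss su) (le_gen_l Ss sv uv) psi.
  rewrite form_genN //; under eq_bigr do rewrite (f's susv _ _ (bruhat_refl u) uv).
  move=> E; have /eqP : c ord0 * act u psi s = 0 by lra.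
  by rewrite mulf_eq0 => /orP[/eqP //|/eqP].
move=> i; case: (unliftP ord0 i) => [j ->|->] //; move: j; apply: restrict => x ux xv phi.
by have := cE x ux xv phi; rewrite c0 !mul0r !add0r.
Qed.
End Potentials.

Lemma left_kernel_neq0 (F : fieldType) n k (A : 'M[F]_(n, k)) : (k < n)%N ->
  exists c : 'rV[F]_n, c != 0%R /\ (c *m A = 0)%R.
Proof.
move=> kn; have /rowV0Pn [c /sub_kermxP cA c0] : kermx A != 0%R; last by exists c.
rewrite -mxrank_eq0 mxrank_ker subn_eq0 -ltnNge.
exact: leq_ltn_trans (rank_leq_col A) kn.
Qed.

(** * Dimension count for generating sets *)

Section LowerBound.
Variable W : coxeterSystem.
Import Order.TTheory GRing.Theory Num.Theory.
Local Open Scope classical_set_scope.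
Local Open Scope ring_scope.
Local Notation T := (@reflections W).
Local Notation len := (@cox_length W).
Local Notation le := (@bruhat_le W).
Implicit Types (u v x y : W).

Section Constancy.
Variables (R : realType) (g : georep R W).

(** If f agrees at a, b, c, then f d - f c = f d - f a lies in the lines of both c^-1 d and a^-1 d.
    These reflections differ because a <> c, so the difference vanishes. *)
Lemma level_diamond_closed u v f : potential g u v f ->
  diamond_closed u v [set e | interval_edges u v e /\
    forall x y, e = [set x; y] -> f x = f y].
Proof.
move=> pf; split=> [e []//|a b c d [ac bd [ab bc cd da]] [_ fab] [_ fbc]].
have Ea := fab _ _ erefl; have Eb := fbc _ _ erefl.
have [adjcd [uc cv] [ud dv]] := interval_edgesP cd.
have [adjda _ [ua av]] := interval_edgesP da.
have adjad := adjacent_sym adjda.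
have mcd := pf c d uc cv ud dv adjcd; have mad := pf a d ua av ud dv adjad.
have ne : (c^-1 * d)%g <> (a^-1 * d)%g by move/mulIg/invg_inj => E; apply: ac.
have E : f d = f c.
  apply/funext => phi; apply/eqP; rewrite -subr_eq0; apply/eqP.
  apply: (root_form_eq0 (adjacent_refl adjcd) (adjacent_refl adjad) ne mcd).
  by have -> : f c = f a by rewrite -Eb.
have fca : f c = f a by rewrite -Eb.
split; split=> // x y /pair_set_eq [[<- <-]|[<- <-]] //.
- by rewrite E fca.
- by rewrite E fca.
Qed.

Lemma level_constant u v (f : W -> (W -> R) -> R) :
  (forall x y, interval_edges u v [set x; y] -> f x = f y) ->
  forall x, le u x -> le x v -> f x = f u.
Proof.
move=> fE x ux; elim: (clos_rt_rtn1 _ _ _ _ ux) => [//|a b ab ua IH] bv.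
have {}ua := clos_rtn1_rt _ _ _ _ ua.
have av : le a v := bruhat_trans (edge_le ab) bv.
rewrite -IH //; apply: fE; apply: interval_edges_adjacent => //.
  by apply: adjacent_sym; case: ab.
exact: bruhat_trans ua (edge_le ab).
Qed.
End Constancy.

(** With k < d(u, v), the k equations at the test vectors leave a nonzero combination G constant
    along F, hence along every edge, against independence. *)
Lemma generating_lower_bound (d : W -> W -> nat) u v k : d_recursion d -> le u v ->
  generating_size u v k -> (d u v <= k)%N.
Proof.
move=> hd uv [F [FE Fgen] Fk]; rewrite leqNgt; apply/negP => kd.
case: (georep_exists Rdefinitions.R W) => g.
have [f [pf indf]] := independent_potentials g hd uv.
have /card_set_bijP [e [_ _ eF]] : (`I_k #= F)%card by exact: card_esym.
have edge j : exists xyb : W * W * (W -> Rdefinitions.R), (j < k)%N -> F (e j) ->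
    e j = [set xyb.1.1; xyb.1.2] /\ forall f, potential g u v f ->
      f xyb.1.2 xyb.2 - f xyb.1.1 xyb.2 = 0 -> f xyb.1.1 = f xyb.1.2.
  (* A dummy value where e j is not in F, since the choice ranges over all natural numbers. *)
  have [Fe|Fe] := pselect (F (e j)); last by exists (u, u, fun=> 0).
  have [x [y [[ux xv] [uy yv] [xy _] eE]]] := FE _ Fe.
  have [b bE] := root_form_dual g (adjacent_refl xy).
  exists (x, y, b) => _ _; split=> // f' pf' /(bE _ (pf' x y ux xv uy yv xy)) H.
  by apply/funext => phi; apply/esym/eqP; rewrite -subr_eq0 H.
have [h hE] := choice edge.
pose A := \matrix_(i < d u v, j < k)
  (f i (h j).1.2 (h j).2 - f i (h j).1.1 (h j).2).
have [c [c0 cA]] := left_kernel_neq0 A kd.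
pose G x phi := \sum_i c ord0 i * f i x phi.
have pG : potential g u v G by exact: potential_sum.
have GF j : (j < k)%N -> F (e j) -> G (h j).1.1 = G (h j).1.2.
  move=> jk Fj; have [_ H] := hE j jk Fj; apply: H => //.
  have := congr1 (fun B : 'rV_k => B ord0 (Ordinal jk)) cA; rewrite !mxE => <-.
  by rewrite /G -sumrB; apply: eq_bigr => i _; rewrite mxE -mulrBr.
have FZ : F `<=` [set e | interval_edges u v e /\ forall x y, e = [set x; y] -> G x = G y].
  move=> E FEE; split; first exact: FE.
  move=> x y Exy; have [j jk ej] := eF _ FEE; have Fj : F (e j) by rewrite ej.
  have [eE _] := hE j jk Fj; have := GF j jk Fj.
  have /pair_set_eq : [set x; y] = [set (h j).1.1; (h j).1.2] by rewrite -eE ej.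
  by case=> [[-> ->]|[-> ->]].
have Z x y : interval_edges u v [set x; y] -> G x = G y.
  rewrite -Fgen => /(_ _ (conj (level_diamond_closed pG) FZ)) [_]; exact.
have cst x : le u x -> le x v -> forall phi, G x phi = G u phi.
  by move=> ux xv phi; rewrite (level_constant Z).
case/eqP: c0; apply/rowP => i; rewrite mxE; exact: (indf (fun i => c ord0 i)).
Qed.

Lemma generating_size_d (d : W -> W -> nat) u v : d_recursion d -> le u v ->
  generating_size u v (d u v).
Proof.
move=> hd uv; have [F [FE Fcard Fgen]] := generating_exists hd uv.
exists F => //; split=> //; apply/seteqP; split; last by move=> e Ee C [Cd FC]; exact: Fgen Ee.
apply: smallest_sub => //; split=> // a b c d' [_ _ []] //.
Qed.
End LowerBound.

Theorem theorem1p2 (W : coxeterSystem) (R : W -> W -> {poly int})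
    (hR : KL_R_family R) (u v : W) (huv : bruhat_le u v) :
  d_invariant R u v = Posz (g_invariant u v).
Proof.
have hd := d_invariant_recursion hR.
have -> : g_invariant u v = `|d_invariant R u v|%N.
  rewrite /g_invariant; set P := [set n | _]%classic.
  have Pd : P `|d_invariant R u v|%N.
    split; first exact: (generating_size_d hd huv).
    by move=> k; exact: (generating_lower_bound hd huv).
  case: xgetP => [n _ [gn minn]|/(_ _ Pd)//].
  apply/eqP; rewrite eqn_leq minn ?(generating_lower_bound hd huv gn) //.
  by case: Pd.
by rewrite gez0_abs // (d_invariant_ge0 hR huv).
Qed.
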